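(* Let $a\ge2$ be an integer, $R=\mathbb{Z}/a\mathbb{Z}$, $0<\epsilon<1$ and $k$ a positive integer. For each $n$, let $1\le\alpha_n^{(k)}<\cdots<\alpha_n^{(1)}\le n$ and $n\ge\beta_n^{(k)}>\cdots>\beta_n^{(1)}\ge1$ be integers, and let $M$ be an $\epsilon$-balanced random $n\times n$ matrix over $R$ having $k$-step stairs of $0$ with respect to $\alpha_n^{(i)}$ and $\beta_n^{(i)}$. If $\lim_{n\to\infty}(n-\alpha_n^{(i)}-\beta_n^{(i)})=\infty$ for every $1\le i\le k$, then for every finite abelian group $G$ whose exponent divides $a$, $$\lim_{n\to\infty}\mathbb{E}(\#\mathrm{Sur}(\mathrm{cok}(M),G))=1.$$
   Context: A random variable $\xi$ in $R=\mathbb{Z}/a\mathbb{Z}$ is $\epsilon$-balanced if for every maximal ideal $\mathcal{P}$ of $R$ and every $r\in R/\mathcal{P}$, $\mathbb{P}(\xi\equiv r\pmod{\mathcal{P}})\le1-\epsilon$. A random $n\times n$ matrix $M$ over $R$ is $\epsilon$-balanced having $k$-step stairs of $0$ with respect to $\alpha_n^{(i)}$ and $\beta_n^{(i)}$ if $M_{i,j}=0$ whenever there is $1\le l\le k$ with $1\le i\le\alpha_n^{(l)}$ and $1\le j\le\beta_n^{(l)}$, and all other entries are independent $\epsilon$-balanced random variables in $R$. $\mathrm{Sur}(A,B)$ is the set of surjective homomorphisms $A\to B$. *)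

(* Defs.v *)
From HB Require Import structures.
From mathcomp Require Import all_boot all_order all_algebra all_fingroup.
From mathcomp Require Import all_solvable.
From mathcomp Require Import all_classical all_reals all_analysis.

Set Implicit Arguments.
Unset Strict Implicit.
Unset Printing Implicit Defensive.

Import Order.TTheory GRing.Theory Num.Theory.
Import numFieldNormedType.Exports.

Local Open Scope ring_scope.

(* [idealr_closed] already requires the ideal to be proper. *)
Definition maximal_ideal (K : finComNzRingType) (I : {set K}) : Prop :=
  idealr_closed I /\
  (forall J : {set K}, idealr_closed J -> I \subset J -> J = I).

Definition colspace (K : finComNzRingType) (m n : nat) (A : 'M[K]_(m, n)) :
    {set 'cV[K]_m} :=
  [set A *m x | x : 'cV[K]_n]%SET.

Lemma colspace_group_set (K : finComNzRingType) (m n : nat)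
  (A : 'M[K]_(m, n)) : group_set (colspace A).
Proof.
apply/group_setP; split.
  by apply/imsetP; exists 0 => //; rewrite mulmx0.
move=> _ _ /imsetP[x _ ->] /imsetP[y _ ->].
by apply/imsetP; exists (x + y) => //; rewrite mulmxDr.
Qed.

Canonical colspace_group (K : finComNzRingType) (m n : nat)
  (A : 'M[K]_(m, n)) := Group (colspace_group_set A).

(* The additive group K^m is abelian, so that every subgroup is normal and the
   type [coset_of] is the full quotient group K^m / A K^n. *)
Definition cok (K : finComNzRingType) (m n : nat) (A : 'M[K]_(m, n)) :
    finGroupType :=
  coset_of (colspace_group A).

Definition Sur (gT rT : finGroupType) : {set {ffun gT -> rT}} :=
  [set f : {ffun gT -> rT} |
    morphic [set: gT] f && [forall y, exists x, f x == y]]%SET.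

(* Positions are numbered from 0, so the 1-based conditions i <= alpha l and
   j <= beta l become strict inequalities. *)
Definition in_stairs (k n : nat) (alpha beta : 'I_k -> nat) (ij : 'I_n * 'I_n) :
    bool :=
  [exists l : 'I_k, (ij.1 < alpha l)%N && (ij.2 < beta l)%N].

Local Open Scope classical_set_scope.

Section Probability.
Context (R : realType) (d : measure_display) (T : measurableType d).
Variable P : probability T R.

(* Measurability for the discrete sigma-algebra on the codomain. *)
Definition discrete_rv (V : Type) (X : T -> V) : Prop :=
  forall A : set V, measurable (X @^-1` A).

(* Mutual independence of the discrete random variables X i, for i in D. *)
Definition mutually_independent (I : finType) (V : Type) (D : {pred I})
    (X : I -> T -> V) : Prop :=
  forall (J : {set I}) (A : I -> set V), J \subset D ->
    P (\bigcap_(i in [set` J]) (X i @^-1` A i)) =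
    (\prod_(i in J) P (X i @^-1` A i))%E.

(* The class r in K / I is given by an arbitrary representative in K. *)
Definition balanced (K : finComNzRingType) (eps : R) (xi : T -> K) : Prop :=
  forall I : {set K}, maximal_ideal I -> forall r : K,
    (P [set w | (xi w - r)%R \in I] <= (1 - eps)%:E)%E.

Definition balanced_stairs (K : finComNzRingType) (eps : R) (k n : nat)
    (alpha beta : 'I_k -> nat) (M : T -> 'M[K]_n) : Prop :=
  let X (ij : 'I_n * 'I_n) (w : T) := M w ij.1 ij.2 in
  [/\ forall ij w, in_stairs alpha beta ij -> X ij w = 0,
      forall ij, ~~ in_stairs alpha beta ij ->
        discrete_rv (X ij) /\ balanced eps (X ij) &
      mutually_independent [pred ij | ~~ in_stairs alpha beta ij] X].

End Probability.

(* Main.v *)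
Require Import Defs.
From HB Require Import structures.
From mathcomp Require Import all_boot all_order all_algebra all_fingroup.
From mathcomp Require Import all_solvable all_field all_character.
From mathcomp Require Import all_classical all_reals all_analysis.
From mathcomp Require Import complex.
From mathcomp Require Import ring lra zify.

(* A surjection cok(M) -> G is a generating family g of G killed by the columns of
   M.  Let D = Hom(G, Z/a) and N = #|G| = #|D|.  Fourier inversion in each column
   gives
     E #Sur = N^-n sum_(g generating) sum_(chi in D^n) prod_(i,j) mu^_ij(chi_j(g_i)),
   where mu^_ij is the Fourier transform of the law of M_ij.  The term chi = 0 is the
   proportion of generating families, which tends to 1.  Balancedness gives
   |mu^_ij(c)| <= r < 1 for c <> 0 outside the stairs, so the other terms are bounded
   by r^E(g, chi), where the energy E(g, chi) is the number of positions outside the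
   stairs with chi_j(g_i) <> 0.

   Enlarging the stairs only increases this bound, so one may keep, for w fixed and n
   large, the last w rows and columns and k + 1 square diagonal blocks.  The sum over
   one square block is bounded independently of its size.  If all the energies are at
   least s the total is O(t^s) with t < 1; if E(g, chi) < s, then the last w columns
   are almost all 0 and, for some chi_j <> 0, the last w rows are almost all in the
   proper subgroup ker chi_j, which is rare when w is a large multiple of s. *)

Set Implicit Arguments.
Unset Strict Implicit.
Unset Printing Implicit Defensive.

Import Order.TTheory GRing.Theory Num.Theory.
Import numFieldNormedType.Exports.

Local Open Scope ring_scope.

(** * Exponential estimates *)

Lemma bernoulli_ge (R : realFieldType) (h : R) (s : nat) :
  -1 <= h -> 1 + s%:R * h <= (1 + h) ^+ s.
Proof.
move=> h1; elim: s => [|s IH]; first by rewrite mul0r addr0 expr0.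
rewrite exprS.
have : (1 + h) * (1 + s%:R * h) <= (1 + h) * (1 + h) ^+ s.
  by apply: ler_wpM2l => //; lra.
apply: le_trans; rewrite -natr1.
have : 0 <= s%:R * h ^+ 2 by rewrite mulr_ge0 ?sqr_ge0.
rewrite expr2; nra.
Qed.

Lemma expr_unbounded (R : realType) (y B : R) :
  1 < y -> exists m : nat, B <= y ^+ m.
Proof.
move=> y1; pose m := Num.Def.truncn (`|B| / (y - 1)); exists m.+1.
have h0 : 0 < y - 1 by lra.
have : `|B| / (y - 1) < m.+1%:R.
  by apply: truncnS_gt; rewrite divr_ge0 ?ltW.
rewrite ltr_pdivrMr // => /ltW h.
have := @bernoulli_ge R (y - 1) m.+1 ltac:(lra).
rewrite [1 + (y - 1)](_ : _ = y); last by ring.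
apply: le_trans; apply: (le_trans (ler_norm B)); lra.
Qed.

Lemma expr_small (R : realType) (t e : R) :
  0 < t < 1 -> 0 < e -> exists m : nat, t ^+ m <= e.
Proof.
move=> /andP[t0 t1] e0.
have [m hm] := @expr_unbounded R t^-1 e^-1 ltac:(by rewrite invf_gt1).
exists m; rewrite -(invrK e) -(invrK t) exprVn lef_pV2 ?qualifE //= ?invr_gt0 //.
by rewrite exprn_gt0 // invr_gt0.
Qed.

Lemma expr_small_all (R : realType) (t e : R) :
  0 < t < 1 -> 0 < e ->
  exists s0 : nat, forall s, (s0 <= s)%N -> t ^+ s <= e.
Proof.
move=> t01 e0; have [m hm] := expr_small t01 e0; exists m => s ms.
case/andP: t01 => t0 t1; apply: le_trans hm.
by rewrite -(subnKC ms) exprD ler_piMr ?exprn_ge0 ?exprn_ile1 ?ltW.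
Qed.

(** The difference of the two sides is ((1 - r) / 2)^2. With t = (1 + r) / 2 this splits r^E into
    t^E t^E: one factor provides smallness, the other is kept to control a sum or a linear
    factor. *)
Lemma le_sqr_midpoint (R : realFieldType) (r : R) : r <= ((1 + r) / 2) ^+ 2.
Proof. have := sqr_ge0 (1 - r); rewrite !expr2; nra. Qed.

Lemma linear_expr_small (R : realType) (r e : R) :
  0 < r < 1 -> 0 < e ->
  exists s0 : nat, forall s, (s0 <= s)%N -> s.+1%:R * r ^+ s <= e.
Proof.
move=> /andP[r0 r1] e0; pose t := (1 + r) / 2.
have t0 : 0 < t by rewrite /t; lra.
have t1 : t < 1 by rewrite /t; lra.
pose h := t^-1 - 1.
have h0 : 0 < h by rewrite subr_gt0 invf_gt1.
(* Bernoulli gives s h <= t^-s, so s t^s <= h^-1; the extra 1 covers the passage from s to s + 1. *)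
pose B := h^-1 + 1.
have B0 : 0 < B by rewrite addr_gt0 ?invr_gt0.
have lin s : s.+1%:R * t ^+ s <= B.
  have ts0 : 0 < t ^+ s by rewrite exprn_gt0.
  have := @bernoulli_ge R h s ltac:(lra).
  rewrite [1 + h](_ : _ = t^-1); last by rewrite /h; ring.
  rewrite exprVn => b.
  rewrite -ler_pdivlMr // -natr1 /B mulrDl mul1r.
  apply: lerD; last by rewrite invf_ge1 // exprn_ile1 ?ltW.
  rewrite -ler_pdivrMl ?invr_gt0 // invrK mulrC; lra.
have [s0 hs0] := @expr_small_all R t (e / B) ltac:(lra) ltac:(exact: divr_gt0).
exists s0 => s /hs0 hs.
have : s.+1%:R * r ^+ s <= s.+1%:R * t ^+ s * t ^+ s.
  rewrite -mulrA ler_wpM2l // -expr2 -exprM mulnC exprM.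
  apply: lerXn2r; rewrite ?qualifE /= ?(ltW r0) ?sqr_ge0 //.
  exact: le_sqr_midpoint.
move/le_trans; apply.
have : s.+1%:R * t ^+ s * t ^+ s <= B * (e / B).
  by apply: ler_pM => //; rewrite ?mulr_ge0 ?exprn_ge0 // ltW.
by rewrite [B * _]mulrC divfK ?gt_eqF.
Qed.

(** Multiply by (1 - x)^n: the product is at most 1, while (1 - x)^n >= 1 / 2 by Bernoulli. *)
Lemma expr_1D_le2 (R : realFieldType) (x : R) (n : nat) :
  0 <= x -> n%:R * x <= 1 / 2 -> (1 + x) ^+ n <= 2.
Proof.
move=> x0 hx; case: n hx => [|n] hx; first by rewrite expr0; lra.
have x1 : x <= 1 / 2.
  by apply: le_trans hx; rewrite ler_peMl // ler1n.
have := @bernoulli_ge R (- x) n.+1 ltac:(lra).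
rewrite mulrN => b.
have h : (1 + x) ^+ n.+1 * (1 - x) ^+ n.+1 <= 1.
  rewrite -exprMn exprn_ile1 //; first by nra.
  by rewrite -subr_ge0; nra.
have p0 : 0 <= (1 + x) ^+ n.+1 by rewrite exprn_ge0 //; lra.
set A := _ ^+ _ in h p0 *; set D := (1 - x) ^+ _ in h b.
have : A * (1 / 2) <= A * D by rewrite ler_wpM2l //; lra.
lra.
Qed.

(** * Sums over configurations of small energy *)

Lemma ler_sum1 (R : numDomainType) (J : finType) (F : J -> R) (j : J) :
  (forall i, 0 <= F i) -> F j <= \sum_i F i.
Proof. by move=> F0; rewrite (bigD1 j) //= lerDl sumr_ge0. Qed.

Lemma prodr_expn_pred (R : comPzRingType) (I : finType) (A P : {pred I}) (z : R) :
  \prod_(i in A) z ^+ (P i) = z ^+ #|[set i in A | P i]%SET|.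
Proof.
rewrite (bigID P) /= [X in _ * X]big1 ?mulr1; last first.
  by move=> i /andP[_ /negbTE ->].
rewrite (eq_bigr (fun=> z)); last by move=> i /andP[_ ->].
rewrite prodr_const; congr (_ ^+ _); apply: eq_card => i.
by rewrite !inE.
Qed.

Section Energy.
Variables (R : realType) (X Y : finType) (nz : Y -> X -> bool) (y0 : Y).

(** In the application X = G, Y = Hom(G, Z/a) and [nz y x] says y(x) <> 0, so that [perp S] is the
    common kernel of the characters in S. *)
Definition perp (S : {set Y}) : {set X} :=
  [set x | [forall y, (y \in S) ==> ~~ nz y x]]%SET.

Definition nzcount (I : finType) (A : {set I}) (g : I -> X) (y : Y) : nat :=
  #|[set i in A | nz y (g i)]%SET|.

Hypothesis y0P : forall x, nz y0 x = false.
Hypothesis cardYX : #|Y| = #|X|.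
Hypothesis perp_card : forall S : {set Y}, (#|S| * #|perp S| <= #|X|)%N.

(** Union bound: every exceptional index is witnessed by some y in S, each y accounts for at most s
    indices, and S has at most #|Y| = #|X| elements. *)
Lemma card_notin_perp (I : finType) (A : {set I}) (g : I -> X) (S : {set Y})
    (s : nat) :
  (forall y, y \in S -> (nzcount A g y <= s)%N) ->
  (#|[set i in A | g i \notin perp S]%SET| <= #|X| * s)%N.
Proof.
move=> hS; have : (\sum_(y in S) nzcount A g y <= #|X| * s)%N.
  apply: (@leq_trans (\sum_(y in S) s)%N); first exact: leq_sum.
  by rewrite sum_nat_const leq_mul2r -cardYX max_card orbT.
apply: leq_trans.
apply: (@leq_trans #|\bigcup_(y in S) [set i in A | nz y (g i)]|%SET).
  apply/subset_leq_card/fintype.subsetP => i; rewrite inE => /andP[iA].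
  rewrite inE => /forallPn[y]; rewrite negb_imply negbK => /andP[yS nzi].
  by apply/bigcupP; exists y; rewrite // inE iA.
apply: (big_ind2 (fun (B : {set I}) k => #|B| <= k)%N) => //.
  by rewrite cards0.
move=> B1 k1 B2 k2 h1 h2; apply: leq_trans (leq_add h1 h2).
by rewrite cardsU leq_subr.
Qed.

Lemma nzcount_y0 (I : finType) (A : {set I}) (g : I -> X) : nzcount A g y0 = 0%N.
Proof.
by apply/eqP; rewrite cards_eq0; apply/eqP/setP=> i; rewrite !inE y0P andbF.
Qed.

Lemma perp_y0 : perp [set y0]%SET = [set: X]%SET.
Proof.
apply/setP=> x; rewrite !inE; apply/forallP=> y; apply/implyP.
by rewrite inE => /eqP->; rewrite y0P.
Qed.

Lemma nzcount_eq0 (I : finType) (A : {set I}) (g : I -> X) (y : Y) (i : I) :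
  nzcount A g y = 0%N -> i \in A -> ~~ nz y (g i).
Proof.
move=> /eqP; rewrite cards_eq0 => /eqP/setP/(_ i); rewrite !inE => h iA.
by move: h; rewrite iA /= => ->.
Qed.

(* The left-hand side is (N^-1 sum_y r^(N_y))^b with N_y = nzcount A g y and
   b = #|A|. Take S = {y | N_y <= b / m}: apart from at most N b / m indices i,
   all g i lie in perp S, and #|S| * #|perp S| <= N.  If N_y = 0 on all of S the
   factor w u = #|S| / N on perp S suffices; otherwise some y in S loses a factor
   1 - c, whose b-th power pays for the exceptional indices. *)
Lemma energy_product_bound (r : R) : 0 < r < 1 ->
  exists (K : R) (w : {set Y} * bool -> X -> R),
  [/\ 0 <= K, forall u x, 0 <= w u x, forall u, \sum_x w u x <= 1 &
      forall (I : finType) (A : {set I}) (g : I -> X),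
        (#|X|%:R^-1 * \sum_y r ^+ nzcount A g y) ^+ #|A| <=
        K * \sum_u \prod_(i in A) w u (g i)].
Proof.
move=> /andP[r0 r1].
have N1 : 1 <= #|X|%:R :> R.
  by rewrite ler1n -cardYX; apply/card_gt0P; exists y0.
set N : R := #|X|%:R in N1 *.
have N0 : 0 < N by lra.
(* If one term of a sum of at most N terms drops from 1 to r, the sum loses 1 - r = 2 c N. This pays
   for a relative loss c and for a tail N r^s <= c / 2. *)
pose c := (1 - r) / (2 * N).
have c0 : 0 < c by rewrite divr_gt0 ?mulr_gt0 //; lra.
have cN : c * N = (1 - r) / 2.
  by rewrite /c; field; rewrite gt_eqF.
have c2 : c <= 1 / 2 by nra.
(* The slacks c / 4 in v and in N z fit under this loss: (1 - c) (1 + c / 4)^2 <= 1, so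
   [w (S, false)] has total mass at most 1. *)
pose v := 1 + c / 4.
have v1 : 1 < v by rewrite /v; lra.
pose z := c / (4 * N).
have z0 : 0 < z by rewrite divr_gt0 // mulr_gt0.
have Nz : N * z = c / 4 by rewrite /z; field; rewrite gt_eqF.
have z1 : z < 1 by nra.
(* m factors v outweigh #|X| factors z. With b >= m * s indices and at most #|X| * s exceptional
   ones, the factors v compensate all the factors z. *)
have [m0 hm0] := @expr_unbounded R v (z^-1 ^+ #|X|) v1.
pose m := m0.+1.
have hm : 1 <= v ^+ m * z ^+ #|X|.
  rewrite -ler_pdivrMr ?exprn_gt0 // div1r -exprVn; apply: (le_trans hm0).
  by rewrite /m exprS ler_peMl ?exprn_ge0 //; lra.
have m1 : 1 <= m%:R :> R by rewrite ler1n.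
have e0 : 0 < c / (2 * N * m%:R) by rewrite divr_gt0 // !mulr_gt0 // ltr0n.
(* For s >= s0 one gets m (s + 1) N r^s <= c / 2, so the tail over y outside S costs at most a
   factor 2 even after raising to the power b <= m (s + 1). *)
have [s0 hs0] := linear_expr_small (introT andP (conj r0 r1)) e0.
pose w (u : {set Y} * bool) (x : X) : R :=
  if u.2 then #|u.1|%:R / N * (x \in perp u.1)%:R
  else #|u.1|%:R / N * (1 - c) * v * z ^+ (x \notin perp u.1).
have w0 u x : 0 <= w u x.
  rewrite /w; case: ifP => _.
    by rewrite mulr_ge0 ?divr_ge0 ?ler0n.
  by rewrite !mulr_ge0 ?exprn_ge0 ?invr_ge0 ?ler0n //; lra.
(* The 2 is the factor lost for large b; for b < m * s0 the uniform weight 1 / N, which is [w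
   ([set y0], true)], suffices up to N^(m * s0). *)
pose K := 2 + N ^+ (m * s0).
have K2 : 2 <= K by rewrite lerDl exprn_ge0 // ltW.
exists K, w; split=> //; first by lra.
  move=> [S []]; rewrite /w /= -mulr_sumr.
    rewrite -natr_sum -big_mkcond /= sum1_card mulrAC ler_pdivrMr // mul1r.
    by rewrite -natrM ler_nat.
  have -> : \sum_x z ^+ (x \notin perp S) =
      #|perp S|%:R + #|~: perp S|%:R * z :> R.
    rewrite (bigID (mem (perp S))) /=; congr (_ + _).
      rewrite (eq_bigr (fun=> 1)) => [|x ->]; last by rewrite expr0.
      by rewrite sumr_const.
    rewrite (eq_bigr (fun=> z)) => [|x ->]; last by rewrite expr1.
    rewrite sumr_const mulr_natl; congr (_ *+ _).
    by apply: eq_card => x; rewrite finset.in_setC.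
  have hS : #|S|%:R <= N by rewrite ler_nat -cardYX max_card.
  have hSp : #|S|%:R * #|perp S|%:R <= N by rewrite -natrM ler_nat.
  have hC : #|~: perp S|%:R <= N by rewrite ler_nat max_card.
  have hA : #|S|%:R / N * (#|perp S|%:R + #|~: perp S|%:R * z) <= 1 + c / 4.
    rewrite mulrAC ler_pdivrMr // mulrDr mulrDl mul1r lerD //.
    by rewrite -Nz mulrA [N * z * N]mulrAC ler_wpM2r ?(ltW z0) // ler_pM.
  have -> : forall p q t : R, p / N * (1 - c) * v * (q + t) =
      (1 - c) * v * (p / N * (q + t)) by move=> p q t; ring.
  apply: (@le_trans _ _ ((1 - c) * v * (1 + c / 4))).
    by rewrite ler_wpM2l // mulr_ge0 //; lra.
  rewrite /v; nra.
move=> I A g; set b := #|A|; set f := \sum_y _.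
have rc (y : Y) : r ^+ nzcount A g y <= 1 by rewrite exprn_ile1 // ltW.
have rc0 (y : Y) : 0 <= r ^+ nzcount A g y by rewrite exprn_ge0 // ltW.
have f0 : 0 <= f by rewrite sumr_ge0.
have prod0 u : 0 <= \prod_(i in A) w u (g i) by rewrite prodr_ge0.
have K0 : 0 <= K by lra.
have [bs|sb] := ltnP b (m * s0).
  have f1 : N^-1 * f <= 1.
    rewrite mulrC ler_pdivrMr // mul1r /f.
    apply: (@le_trans _ _ (\sum_(y : Y) 1)); first exact: ler_sum.
    by rewrite sumr_const cardYX.
  apply: (@le_trans _ _ 1); first by rewrite exprn_ile1 // mulr_ge0 ?invr_ge0 // ltW.
  have h1 : \prod_(i in A) w ([set y0]%SET, true) (g i) = N^-1 ^+ b.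
    rewrite -prodr_const; apply: eq_bigr => i _.
    by rewrite /w /= perp_y0 inE cards1 mulr1 mul1r.
  apply: (@le_trans _ _ (N ^+ (m * s0) * N^-1 ^+ b)).
    rewrite exprVn ler_pdivlMr ?exprn_gt0 // mul1r.
    by rewrite ler_weXn2l // ltnW.
  rewrite -h1; apply: ler_pM; rewrite ?exprn_ge0 ?(ltW N0) ?prodr_ge0 //.
    by rewrite /K; lra.
  exact: (@ler_sum1 _ _ (fun u => \prod_(i in A) w u (g i)) _ prod0).
set s := (b %/ m)%N.
have ss : (s0 <= s)%N by rewrite leq_divRL // mulnC.
have bm : (m * s <= b)%N by rewrite mulnC leq_trunc_div.
have bm' : (b <= m * s.+1)%N by rewrite mulnC ltnW // ltn_ceil.
have hs := hs0 s ss.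
have rs0 : 0 < r ^+ s by rewrite exprn_gt0.
have hs' : m%:R * s.+1%:R * (N * r ^+ s) <= c / 2.
  move: hs; rewrite ler_pdivlMr; last by rewrite !mulr_gt0 // ltr0n.
  by move: (s.+1%:R) (r ^+ s) => p q; lra.
have hNr : N * r ^+ s <= c / 2.
  apply: le_trans hs'; rewrite ler_peMl ?mulr_ge0 ?(ltW N0) ?(ltW rs0) //.
  by rewrite mulr_ege1 // ler1n.
pose S := [set y | (nzcount A g y <= s)%N]%SET.
have y0S : y0 \in S by rewrite inE nzcount_y0.
have S1 : 1 <= #|S|%:R :> R by rewrite ler1n; apply/card_gt0P; exists y0.
have SN : #|S|%:R <= N by rewrite ler_nat -cardYX max_card.
have fS : f <= \sum_(y in S) r ^+ nzcount A g y + N * r ^+ s.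
  rewrite /f (bigID (mem S)) /= lerD //.
  apply: (@le_trans _ _ (\sum_(y | y \notin S) r ^+ s)).
    apply: ler_sum => y; rewrite inE -ltnNge => /ltnW ys.
    by rewrite ler_wiXn2l // ltW.
  rewrite sumr_const -[leLHS]mulr_natl ler_wpM2r // ?(ltW rs0) //.
  by rewrite /N -cardYX ler_nat max_card.
have main u : (N^-1 * f) ^+ b <= 2 * \prod_(i in A) w u (g i) ->
    (N^-1 * f) ^+ b <= K * \sum_u \prod_(i in A) w u (g i).
  move/le_trans; apply; apply: ler_pM => //.
  exact: (@ler_sum1 _ _ (fun u => \prod_(i in A) w u (g i)) _ prod0).
have [allz|] := boolP [forall y, (y \in S) ==> (nzcount A g y == 0%N)].
  apply: (main (S, true)).
  have -> : \prod_(i in A) w (S, true) (g i) = (#|S|%:R / N) ^+ b.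
    rewrite -prodr_const; apply: eq_bigr => i iA; rewrite /w /=.
    suff -> : g i \in perp S by rewrite mulr1.
    rewrite inE; apply/forallP=> y; apply/implyP=> yS.
    by move/forallP: allz => /(_ y); rewrite yS => /eqP/nzcount_eq0; apply.
  have fS' : f <= #|S|%:R * (1 + N * r ^+ s).
    apply: (le_trans fS); rewrite mulrDr mulr1 lerD //.
      apply: (@le_trans _ _ (\sum_(y in S) 1)); first exact: ler_sum.
      by rewrite sumr_const.
    by rewrite ler_peMl // mulr_ge0 // ltW.
  apply: (@le_trans _ _ ((#|S|%:R / N * (1 + N * r ^+ s)) ^+ b)).
    apply: lerXn2r; rewrite ?qualifE /=.
    + by rewrite mulr_ge0 // invr_ge0 ltW.
    + by rewrite !mulr_ge0 ?invr_ge0 ?addr_ge0 ?mulr_ge0 // ltW.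
    + by rewrite mulrC mulrAC ler_pM2r // invr_gt0.
  rewrite exprMn mulrC ler_wpM2r ?exprn_ge0 ?divr_ge0 ?ler0n ?(ltW N0) //.
  apply: (@le_trans _ _ ((1 + N * r ^+ s) ^+ (m * s.+1))).
    by rewrite ler_weXn2l // lerDl mulr_ge0 // ltW.
  apply: expr_1D_le2; first by rewrite mulr_ge0 // ltW.
  by rewrite natrM; lra.
case/forallPn => y1; rewrite negb_imply -lt0n => /andP[y1S y1c].
apply: (main (S, false)).
rewrite /w /= big_split /= prodr_const -/b prodr_expn_pred.
have f1c : N^-1 * f <= #|S|%:R / N * (1 - c).
  rewrite mulrC mulrAC ler_pM2r ?invr_gt0 //; apply: (le_trans fS).
  have : \sum_(y in S) r ^+ nzcount A g y <= r + (#|S|%:R - 1).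
    rewrite (bigD1 y1) //= lerD //.
      rewrite -[leRHS]expr1 ler_wiXn2l ?ltW //.
    apply: (@le_trans _ _ (\sum_(y in S | y != y1) 1)).
      exact: ler_sum.
    rewrite -[leRHS](_ : \sum_(y in S) 1 - 1 = _); last by rewrite sumr_const.
    by rewrite [X in _ <= X - 1](bigD1 y1) //= addrAC subrr add0r.
  nra.
apply: (@le_trans _ _ ((#|S|%:R / N * (1 - c)) ^+ b)).
  apply: lerXn2r; rewrite ?qualifE /= ?mulr_ge0 ?invr_ge0 ?(ltW N0) //; lra.
set q := #|S|%:R / N * (1 - c).
have q0 : 0 <= q by rewrite !mulr_ge0 ?invr_ge0 ?(ltW N0) //; lra.
rewrite [(q * v) ^+ b]exprMn -mulrA [2 * _]mulrCA ler_peMr ?exprn_ge0 //.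
set e := #|_|.
have es : (e <= #|X| * s)%N.
  by apply: card_notin_perp => y; rewrite inE.
have : 1 <= v ^+ b * z ^+ e.
  apply: (@le_trans _ _ ((v ^+ m * z ^+ #|X|) ^+ s)); first exact: exprn_ege1.
  have v0 : 0 <= v by rewrite (le_trans ler01) // ltW.
  rewrite exprMn -!exprM; apply: ler_pM; rewrite ?exprn_ge0 ?(ltW z0) //.
    by rewrite ler_weXn2l // ltW.
  by rewrite ler_wiXn2l // ltW.
lra.
Qed.

(** * Sums over labelled square blocks *)

Definition fibre (I L : finType) (lab : I -> L) (c : L) : {set I} :=
  [set i | lab i == c]%SET.

Lemma prod_fibres (I L : finType) (lab : I -> L) (F : L -> I -> R) :
  \prod_c \prod_(i in fibre lab c) F c i = \prod_i F (lab i) i.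
Proof.
rewrite [RHS](partition_big lab xpredT) //=; apply: eq_bigr => c _.
by apply: eq_big => [i|i]; rewrite inE // => /eqP ->.
Qed.

(** Bound each block by the mixture of product weights from [energy_product_bound] and expand into a
    choice u of one weight per label. For fixed u the sum over g factors over the indices: an index
    outside P contributes at most 1, one inside P contributes the mass of v. Only the number of
    labels enters the constant, not the block sizes. *)
Lemma labelled_sum_bound (r : R) : 0 < r < 1 ->
  exists2 C : R, 0 <= C &
  forall (I L : finType) (lab : I -> L) (P : pred L) (v : X -> R),
    (forall x, 0 <= v x) ->
    \sum_(g : {ffun I -> X}) \prod_c
      (if P c then \prod_(i in fibre lab c) v (g i)
       else (#|X|%:R^-1 * \sum_y r ^+ nzcount (fibre lab c) g y)
              ^+ #|fibre lab c|) <=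
    C ^+ #|L| * (\sum_x v x) ^+ #|[set i | P (lab i)]%SET|.
Proof.
move=> r01; have [K [w [K0 w0 w1 hw]]] :=
  energy_product_bound r01.
pose J := ({set Y} * bool)%type.
exists ((K + 1) * #|{: J}|%:R) => [|I L lab P v v0].
  by rewrite mulr_ge0 ?addr_ge0.
pose W (c : L) (u : J) (x : X) := if P c then v x else w u x.
have W0 c u x : 0 <= W c u x by rewrite /W; case: ifP.
have step (g : {ffun I -> X}) (c : L) :
    0 <= (if P c then \prod_(i in fibre lab c) v (g i)
       else (#|X|%:R^-1 * \sum_y r ^+ nzcount (fibre lab c) g y)
              ^+ #|fibre lab c|) <=
    \sum_(u : J) (K + 1) * \prod_(i in fibre lab c) W c u (g i).
  have p0 u : 0 <= \prod_(i in fibre lab c) W c u (g i) by rewrite prodr_ge0.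
  rewrite -mulr_sumr /W; case: ifP => Pc; apply/andP; split.
  - by rewrite prodr_ge0.
  - have q0 : 0 <= \prod_(i in fibre lab c) v (g i) by rewrite prodr_ge0.
    rewrite sumr_const -[_ *+ _]mulr_natr mulrCA ler_peMr // mulr_ege1 ?lerDr //.
    by rewrite ler1n; apply/card_gt0P; exists (finset.set0, true).
  - rewrite exprn_ge0 // mulr_ge0 ?invr_ge0 // sumr_ge0 // => y _.
    by rewrite exprn_ge0 //; case/andP: r01 => /ltW.
  - apply: (le_trans (hw _ _ _)); rewrite ler_wpM2r ?lerDl //.
    by rewrite sumr_ge0 // => u _; rewrite prodr_ge0.
apply: (@le_trans _ _ (\sum_(g : {ffun I -> X}) \prod_c
   \sum_(u : J) (K + 1) * \prod_(i in fibre lab c) W c u (g i))).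
  by apply: ler_sum => g _; apply: ler_prod => c _; apply: step.
under eq_bigr => g _ do rewrite bigA_distr_bigA /=.
rewrite exchange_big /= exprMn -mulrA.
have -> : (#|{: J}|%:R : R) ^+ #|L| = \sum_(u : {ffun L -> J}) 1.
  by rewrite sumr_const card_ffun natrX.
rewrite mulr_suml mulr_sumr; apply: ler_sum => u _.
under eq_bigr => g _ do rewrite big_split /= prodr_const
  (prod_fibres lab (fun c i => W c (u c) (g i))).
rewrite -mulr_sumr mul1r ler_wpM2l ?exprn_ge0 ?addr_ge0 //.
rewrite -(bigA_distr_bigA (fun i x => W (lab i) (u (lab i)) x)) /=.
rewrite (bigID (fun i => P (lab i))) /= -[leRHS]mulr1; apply: ler_pM.
- by rewrite prodr_ge0 // => i _; rewrite sumr_ge0.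
- by rewrite prodr_ge0 // => i _; rewrite sumr_ge0.
- rewrite -prodr_const le_eqVlt; apply/orP; left; apply/eqP.
  apply: eq_big => [i|i Pi]; first by rewrite inE.
  by rewrite /W Pi.
- apply: prodr_ile1 => i /negbTE Pi; apply/andP; split; first by rewrite sumr_ge0.
  by rewrite /W Pi.
Qed.

(* After possibly adding zeros, the nonzero entries of the matrix are the diagonal
   blocks of equally labelled rows and columns together with the rows and columns
   labelled c0. *)
Definition allowed (I L : finType) (labr labc : I -> L) (c0 : L) (i j : I) :=
  [|| labr i == c0, labc j == c0 | labr i == labc j].

Definition col_energy (I L : finType) (labr labc : I -> L) (c0 : L)
    (g : I -> X) (h : I -> Y) (j : I) : nat :=
  #|[set i | allowed labr labc c0 i j && nz (h j) (g i)]%SET|.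

Lemma leq_sum1 (J : finType) (F : J -> nat) (j : J) : (F j <= \sum_i F i)%N.
Proof. by rewrite (bigD1 j) //= leq_addr. Qed.

(* Configurations of energy at least s are bounded by t^s times a product over
   the labels of the square-block sums.  If the energy is smaller than s, at most
   s columns labelled c0 differ from y0 (each of these meets a generator), and any
   column h j <> y0 is orthogonal to all but s of the rows labelled c0; such g and
   h are counted by the Chernoff weight z. *)
Lemma energy_sum_bound (L : finType) (r : R) : 0 < r < 1 ->
  exists (m0 : nat) (C t : R), [/\ 0 <= C, 0 < t < 1 &
  forall (I : finType) (labr labc : I -> L) (c0 : L) (s : nat),
    (forall c, #|fibre labr c| = #|fibre labc c|) ->
    (m0 * s <= #|fibre labr c0|)%N ->
    #|X|%:R^-1 ^+ #|I| *
    (\sum_(g : {ffun I -> X} | [forall y, (y != y0) ==> [exists i, nz y (g i)]])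
      \sum_(h : {ffun I -> Y} | h != [ffun=> y0])
        \prod_j r ^+ col_energy labr labc c0 g h j) <= C * t ^+ s].
Proof.
move=> r01; case/andP: (r01) => r0 r1.
have N1 : 1 <= #|X|%:R :> R.
  by rewrite ler1n -cardYX; apply/card_gt0P; exists y0.
pose t := (1 + r) / 2.
have t01 : 0 < t < 1 by rewrite /t; lra.
case/andP: (t01) => t0 t1.
have [Cr Cr0 hr] := labelled_sum_bound r01.
have [Ct Ct0 ht] := labelled_sum_bound t01.
set N : R := #|X|%:R in N1 hr ht *.
have N0 : 0 < N by lra.
have [z z0 Nz] : exists2 z : R, 0 < z & N * z = 1 / 4.
  exists (4 * N)^-1; first by rewrite invr_gt0 mulr_gt0.
  by field; rewrite gt_eqF.
have z1 : z < 1 by nra.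
(* 25 / 32 = (5 / 4) (5 / 8) bounds one column and one row labelled c0 together: (1 + N z) / N for
   the column, N / 2 + N z <= 5 N / 8 for the row, as N >= 2. Then m0 such pairs absorb a factor
   z^-2 and leave 1 / 2 <= t. *)
have [m0 hm0] := @expr_small R (25 / 32) (z ^+ 2 / 2) ltac:(lra)
   ltac:(by rewrite divr_gt0 // exprn_gt0).
exists m0, (Ct ^+ #|L| + N * Cr ^+ #|L|), t; split=> //.
  by rewrite addr_ge0 ?mulr_ge0 ?exprn_ge0 ?(ltW N0).
move=> I labr labc c0 s eqc hs.
have cE g h j : (nzcount (fibre labr (labc j)) g (h j) <=
    col_energy labr labc c0 g h j)%N.
  apply/subset_leq_card/fintype.subsetP => i; rewrite !inE /allowed.
  by case/andP=> -> ->; rewrite !orbT.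
have cE0 g h j : (nzcount (fibre labr c0) g (h j) <=
    col_energy labr labc c0 g h j)%N.
  apply/subset_leq_card/fintype.subsetP => i; rewrite !inE /allowed.
  by case/andP=> -> ->.
(* G1 serves for energy at least s, G2 for smaller energy. In G2 a column labelled c0 is charged
   only for being nonzero; the other columns keep the energy of their own block. *)
pose G1 g (j : I) y : R := t ^+ nzcount (fibre labr (labc j)) g y.
pose G2 g (j : I) y : R := if labc j == c0 then z ^+ (y != y0) else
   r ^+ nzcount (fibre labr (labc j)) g y.
have z1s : 0 < z ^+ s by rewrite exprn_gt0.
have G20 g j y : 0 <= G2 g j y.
  by rewrite /G2; case: ifP => _; rewrite exprn_ge0 // ltW.
(* Either term on the right may be the one that dominates. In the second, z^-1^(2 s) compensates
   z^e1 z^e2 with e1, e2 <= s, where e1 counts the rows labelled c0 on which y1 = h j1 is nonzero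
   and e2 the nonzero columns labelled c0. *)
have key (g : {ffun I -> X}) (h : {ffun I -> Y}) :
    [forall y, (y != y0) ==> [exists i, nz y (g i)]] -> h != [ffun=> y0] ->
    \prod_j r ^+ col_energy labr labc c0 g h j <=
    t ^+ s * (\prod_j G1 g j (h j)) + z^-1 ^+ (2 * s) *
      \sum_(y1 | y1 != y0) (\prod_(i in fibre labr c0) z ^+ (nz y1 (g i))) *
      (\prod_j G2 g j (h j)).
  move=> gen hn.
  have T20 : 0 <= z^-1 ^+ (2 * s) * \sum_(y1 | y1 != y0)
      (\prod_(i in fibre labr c0) z ^+ (nz y1 (g i))) * (\prod_j G2 g j (h j)).
    rewrite mulr_ge0 ?exprn_ge0 ?invr_ge0 ?(ltW z0) // sumr_ge0 // => y1 _.
    by rewrite mulr_ge0 // prodr_ge0 // => i _; rewrite exprn_ge0 // ltW.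
  have T10 : 0 <= t ^+ s * (\prod_j G1 g j (h j)).
    by rewrite mulr_ge0 ?prodr_ge0 // => [|i _]; rewrite exprn_ge0 // ltW.
  rewrite prodrXr; set Etot := (\sum_j _)%N.
  have [sE|/ltnW Es] := leqP s Etot.
    rewrite -[leLHS]addr0 lerD //.
    apply: (@le_trans _ _ (t ^+ s * t ^+ Etot)).
      apply: (@le_trans _ _ ((t ^+ 2) ^+ Etot)).
        apply: lerXn2r; rewrite ?qualifE /= ?(ltW r0) ?sqr_ge0 //.
        exact: le_sqr_midpoint.
      rewrite -exprM -exprD ler_wiXn2l ?(ltW t0) ?(ltW t1) //.
      by rewrite mul2n -addnn leq_add2r.
    rewrite ler_wpM2l ?exprn_ge0 ?(ltW t0) // -prodrXr ler_prod // => j _.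
    by rewrite exprn_ge0 ?(ltW t0) //= ler_wiXn2l ?(ltW t0) ?(ltW t1).
  rewrite -[leLHS]add0r lerD //.
  have [j1 hj1] : exists j1, h j1 != y0.
    apply/existsP; apply: contraNT hn => /existsPn hn.
    by apply/eqP/ffunP => j; rewrite ffunE; apply/eqP; rewrite -[_ == _]negbK.
  rewrite (bigD1 (h j1)) //= mulrDr -[leLHS]addr0 lerD //; last first.
    rewrite mulr_ge0 ?exprn_ge0 ?invr_ge0 ?(ltW z0) // sumr_ge0 // => y1 _.
    by rewrite mulr_ge0 // prodr_ge0 // => i _; rewrite exprn_ge0 // ltW.
  rewrite prodr_expn_pred -/(nzcount _ _ _).
  set e1 := nzcount _ _ _.
  have e1s : (e1 <= s)%N.
    apply: leq_trans (cE0 g h j1) (leq_trans _ Es).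
    exact: (leq_sum1 (col_energy labr labc c0 g h) j1).
  pose e2 := (\sum_(j in fibre labc c0) (h j != y0))%N.
  have e2s : (e2 <= s)%N.
    apply: leq_trans Es; rewrite /Etot (bigID (mem (fibre labc c0))) /=.
    apply: leq_trans (leq_addr _ _); apply: leq_sum => j; rewrite inE => /eqP jc.
    have [//|hj] := eqVneq (h j) y0.
    move/forallP: gen => /(_ (h j)); rewrite hj /= => /existsP[i nzi].
    by apply/card_gt0P; exists i; rewrite inE nzi /allowed jc eqxx orbT.
  have G2e : z ^+ e2 * r ^+ Etot <= \prod_j G2 g j (h j).
    rewrite (bigID (mem (fibre labc c0))) /=; apply: ler_pM.
    - by rewrite exprn_ge0 // ltW.
    - by rewrite exprn_ge0 // ltW.
    - rewrite /e2 -prodrXr; apply: ler_prod => j; rewrite inE => jc.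
      by rewrite exprn_ge0 ?(ltW z0) //= /G2 jc.
    - apply: (@le_trans _ _ (\prod_(j | j \notin fibre labc c0)
                r ^+ col_energy labr labc c0 g h j)).
        rewrite prodrXr ler_wiXn2l ?(ltW r0) ?(ltW r1) //.
        rewrite /Etot [leqRHS](bigID (mem (fibre labc c0))) /=.
        exact: leq_addl.
      apply: ler_prod => j; rewrite inE => /negbTE jc.
      by rewrite exprn_ge0 ?(ltW r0) //= /G2 jc ler_wiXn2l ?(ltW r0) ?(ltW r1).
  apply: (@le_trans _ _ (z^-1 ^+ (2 * s) * (z ^+ e1 * (z ^+ e2 * r ^+ Etot)))).
    rewrite !mulrA ler_peMl ?exprn_ge0 ?(ltW r0) //.
    rewrite exprVn -mulrA -exprD ler_pdivlMl ?exprn_gt0 // mulr1.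
    by rewrite ler_wiXn2l ?(ltW z0) ?(ltW z1) // mul2n -addnn leq_add.
  rewrite ler_wpM2l ?exprn_ge0 ?invr_ge0 ?(ltW z0) //.
  by rewrite ler_wpM2l ?exprn_ge0 // ltW.
have colprod (F : L -> R) : \prod_j F (labc j) = \prod_c F c ^+ #|fibre labr c|.
  rewrite -(prod_fibres labc (fun c _ => F c)).
  by apply: eq_bigr => c _; rewrite eqc prodr_const.
have T1 : N^-1 ^+ #|I| * (\sum_(g : {ffun I -> X}) \sum_(h : {ffun I -> Y})
    \prod_j G1 g j (h j)) <= Ct ^+ #|L|.
  have := ht I L labr xpred0 (fun=> 0) (fun=> lexx 0).
  have -> : #|[set i | xpred0 (labr i)]%SET| = 0%N.
    by apply/eqP; rewrite cards_eq0; apply/eqP/setP => i; rewrite !inE.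
  rewrite expr0 mulr1.
  apply: le_trans; rewrite mulr_sumr; apply: ler_sum => g _.
  rewrite -(bigA_distr_bigA (G1 g)) -prodr_const -big_split /=.
  by rewrite (colprod (fun c => N^-1 * \sum_y t ^+ nzcount (fibre labr c) g y)).
have T2 y1 : y1 != y0 -> N^-1 ^+ #|I| *
    (\sum_(g : {ffun I -> X}) \sum_(h : {ffun I -> Y})
      (\prod_(i in fibre labr c0) z ^+ (nz y1 (g i))) * \prod_j G2 g j (h j))
    <= Cr ^+ #|L| * (25 / 32) ^+ #|fibre labr c0|.
  (* q is the averaged sum over one column labelled c0. There are as many such columns as rows, so
     one q is attached to each row, giving the weight q z^(nz y1 x). *)
  move=> y10; pose q := N^-1 * \sum_y z ^+ (y != y0).
  have q0 : 0 <= q.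
    rewrite mulr_ge0 ?invr_ge0 ?(ltW N0) ?sumr_ge0 // => y _.
    by rewrite exprn_ge0 // ltW.
  have v0 x : 0 <= q * z ^+ (nz y1 x) by rewrite mulr_ge0 // exprn_ge0 // ltW.
  have := hr I L labr (pred1 c0) (fun x => q * z ^+ (nz y1 x)) v0.
  rewrite -/(fibre labr c0) => h.
  apply: (@le_trans _ _ _ _ _ (le_trans _ h)); last first.
    rewrite ler_wpM2l ?exprn_ge0 //; apply: lerXn2r; rewrite ?qualifE /=; try lra.
      by rewrite sumr_ge0.
    (* The kernel of y1 <> y0 contains at most half of X, by [perp_card] for the pair y0, y1. *)
    have cardk : 2 * #|[set x | ~~ nz y1 x]%SET|%:R <= N.
      rewrite -natrM ler_nat; apply: leq_trans (perp_card [set y0; y1]).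
      rewrite cards2 eq_sym y10 leq_mul2l /=.
      apply/subset_leq_card/fintype.subsetP => x; rewrite !inE => nx.
      apply/forallP => y; rewrite !inE; apply/implyP.
      by case/orP => /eqP -> //; rewrite y0P.
    have N2 : 2 <= N.
      rewrite ler_nat -cardYX (leq_trans _ (max_card [set y0; y1]%SET)) //.
      by rewrite cards2 eq_sym y10.
    have s1 : \sum_y z ^+ (y != y0) <= 1 + N * z.
      rewrite (bigD1 y0) //= eqxx expr0 lerD2l.
      rewrite (eq_bigr (fun=> z)) => [|y ->]; last by rewrite expr1.
      rewrite sumr_const -[leLHS]mulr_natl ler_wpM2r ?(ltW z0) //.
      by rewrite /N -cardYX ler_nat max_card.
    have s2 : \sum_x z ^+ (nz y1 x) <= #|[set x | ~~ nz y1 x]%SET|%:R + N * z.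
      rewrite (bigID (fun x => ~~ nz y1 x)) /= lerD //.
        rewrite (eq_bigr (fun=> 1)) => [|x /negbTE ->]; last by rewrite expr0.
        by rewrite sumr_const cardsE.
      rewrite (eq_bigr (fun=> z)) => [|x /negbNE ->]; last by rewrite expr1.
      rewrite sumr_const -[leLHS]mulr_natl ler_wpM2r ?(ltW z0) //.
      by rewrite ler_nat max_card.
    rewrite -mulr_sumr /q -mulrA ler_pdivrMl //.
    apply: (@le_trans _ _ ((1 + N * z) * (#|[set x | ~~ nz y1 x]%SET|%:R + N * z))).
      by apply: ler_pM => //; apply: sumr_ge0 => y _; rewrite exprn_ge0 // ltW.
    rewrite Nz; lra.
  rewrite mulr_sumr; apply: ler_sum => g _.
  rewrite -mulr_sumr mulrCA -(bigA_distr_bigA (G2 g)) -prodr_const -big_split /=.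
  rewrite (colprod (fun c => N^-1 * \sum_y (if c == c0 then z ^+ (y != y0)
     else r ^+ nzcount (fibre labr c) g y))).
  rewrite (bigD1 c0) //= eqxx [leRHS](bigD1 c0) //= eqxx -/q mulrA.
  rewrite big_split /= prodr_const [q ^+ _ * _]mulrC.
  rewrite [X in _ * X <= _](eq_bigr (fun c => if c == c0
     then \prod_(i in fibre labr c) (q * z ^+ nz y1 (g i))
     else (N^-1 * \sum_y r ^+ nzcount (fibre labr c) g y) ^+ #|fibre labr c|)) //.
  by move=> c /negbTE cc0; rewrite cc0.
apply: (@le_trans _ _ (N^-1 ^+ #|I| *
  \sum_(g : {ffun I -> X}) \sum_(h : {ffun I -> Y})
    (t ^+ s * (\prod_j G1 g j (h j)) + z^-1 ^+ (2 * s) *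
      \sum_(y1 | y1 != y0) (\prod_(i in fibre labr c0) z ^+ (nz y1 (g i))) *
      (\prod_j G2 g j (h j))))).
  rewrite ler_wpM2l ?exprn_ge0 ?invr_ge0 ?(ltW N0) //.
  have B0 (g : {ffun I -> X}) (h : {ffun I -> Y}) :
    0 <= t ^+ s * (\prod_j G1 g j (h j)) + z^-1 ^+ (2 * s) *
      \sum_(y1 | y1 != y0) (\prod_(i in fibre labr c0) z ^+ (nz y1 (g i))) *
      (\prod_j G2 g j (h j)).
    rewrite addr_ge0 // mulr_ge0 ?exprn_ge0 ?invr_ge0 ?(ltW z0) ?(ltW t0) //.
      by rewrite prodr_ge0 // => j _; rewrite exprn_ge0 // ltW.
    rewrite sumr_ge0 // => y1 _.
    by rewrite mulr_ge0 // prodr_ge0 // => i _; rewrite exprn_ge0 // ltW.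
  rewrite big_mkcond /=; apply: ler_sum => g _; case: ifP => [gen|_]; last first.
    by rewrite sumr_ge0.
  rewrite big_mkcond /=; apply: ler_sum => h _; case: ifP => // hn.
  exact: key.
under eq_bigr => g _ do rewrite big_split /= -!mulr_sumr.
rewrite big_split /= -!mulr_sumr mulrDr mulrCA mulrDl lerD //.
  by rewrite mulrC ler_wpM2r // exprn_ge0 // ltW.
under eq_bigr => g _ do rewrite exchange_big /=.
rewrite exchange_big /= mulrCA mulr_sumr.
have hz : z^-1 ^+ (2 * s) * (25 / 32) ^+ #|fibre labr c0| <= t ^+ s.
  rewrite mulrC exprVn ler_pdivrMr ?exprn_gt0 // exprM -exprMn.
  apply: (@le_trans _ _ ((25 / 32) ^+ (m0 * s))).
    by rewrite ler_wiXn2l //; lra.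
  rewrite exprM; apply: lerXn2r;
    rewrite ?qualifE /= ?exprn_ge0 ?mulr_ge0 ?(ltW t0) ?sqr_ge0 //; try lra.
  apply: (le_trans hm0); have := sqr_ge0 z; rewrite /t; nra.
apply: (@le_trans _ _ (z^-1 ^+ (2 * s) *
  (\sum_(y1 | y1 != y0) Cr ^+ #|L| * (25 / 32) ^+ #|fibre labr c0|))).
  rewrite ler_wpM2l ?exprn_ge0 ?invr_ge0 ?(ltW z0) //.
  exact: ler_sum.
rewrite sumr_const -[_ *+ _]mulr_natl mulrCA -[leRHS]mulrA; apply: ler_pM => //.
- by rewrite !mulr_ge0 ?exprn_ge0 ?invr_ge0 ?(ltW z0) //; lra.
- by rewrite /N -cardYX ler_nat max_card.
- by rewrite mulrCA ler_wpM2l ?exprn_ge0.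
Qed.

End Energy.

(** * Duality for abelian groups of exponent dividing a *)

Section DualGroup.
Variables (a : nat) (gT : finGroupType).

Definition additive_on (f : {ffun gT -> 'Z_a}) : bool :=
  [forall p : gT * gT, f (p.1 * p.2)%g == f p.1 + f p.2].

Definition dual : Type := {f : {ffun gT -> 'Z_a} | additive_on f}.

HB.instance Definition _ := SubType.on dual.
HB.instance Definition _ := Finite.on dual.

Definition dual_app (f : dual) (x : gT) : 'Z_a := sval f x.

Lemma dual_appM (f : dual) (x y : gT) :
  dual_app f (x * y)%g = dual_app f x + dual_app f y.
Proof. by move/forallP: (svalP f) => /(_ (x, y))/eqP. Qed.

Lemma dual_app1 (f : dual) : dual_app f 1%g = 0.
Proof. by apply: (addrI (dual_app f 1%g)); rewrite -dual_appM mulg1 addr0. Qed.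

Lemma dual_appX (f : dual) (x : gT) (m : nat) :
  dual_app f (x ^+ m)%g = dual_app f x *+ m.
Proof.
by elim: m => [|m IH]; rewrite ?dual_app1 // expgS dual_appM IH mulrS.
Qed.

Lemma dual_app_prod (f : dual) (I : Type) (s : seq I) (F : I -> gT) :
  dual_app f (\prod_(i <- s) F i)%g = \sum_(i <- s) dual_app f (F i).
Proof.
by elim/big_rec2: _ => [|i x y _ <-]; rewrite ?dual_app1 ?dual_appM.
Qed.

Lemma dual_eq (f1 f2 : dual) : dual_app f1 =1 dual_app f2 -> f1 = f2.
Proof. by move=> h; apply/val_inj/ffunP. Qed.

Lemma additive_on0 : additive_on [ffun=> 0].
Proof. by apply/forallP => p; rewrite !ffunE addr0. Qed.

Definition dual0 : dual := exist additive_on _ additive_on0.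

Lemma dual_app0 (x : gT) : dual_app dual0 x = 0.
Proof. by rewrite /dual_app /= ffunE. Qed.

Lemma additive_onD (f1 f2 : dual) :
  additive_on [ffun x => dual_app f1 x + dual_app f2 x].
Proof. by apply/forallP => p; rewrite !ffunE !dual_appM addrACA. Qed.

Definition dual_add (f1 f2 : dual) : dual :=
  exist additive_on _ (additive_onD f1 f2).

Lemma dual_app_add (f1 f2 : dual) (x : gT) :
  dual_app (dual_add f1 f2) x = dual_app f1 x + dual_app f2 x.
Proof. by rewrite /dual_app /= ffunE. Qed.

Lemma dual_add_inj (f : dual) : injective (dual_add f).
Proof.
move=> f1 f2 eqf; apply: dual_eq => x; apply: (addrI (dual_app f x)).
by rewrite -!dual_app_add eqf.
Qed.

(* A linear character of G over algC not killing x takes its values in the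
   group of a-th roots of unity; its discrete logarithm lands in Z/a. *)
Lemma dual_separates (x : gT) : (1 < a)%N -> abelian [set: gT]%SET ->
  (exponent [set: gT]%SET %| a)%N -> x != 1%g -> exists f, dual_app f x != 0.
Proof.
move=> a1 abG expG xn1.
(* The kernels of the irreducible characters intersect trivially. *)
have [i xi] : exists i : Iirr [set: gT]%G, x \notin cfker 'chi_i.
  apply/existsP; apply: contraNT xn1 => /existsPn h.
  rewrite -finset.in_set1 -set1gE -(TI_cfker_irr [set: gT]%G).
  by apply/bigcapP => i _; rewrite -[_ \in _]negbK.
have chil : 'chi_i \is a linear_char by apply/char_abelianP.
have [w prw] := C_prim_root_exists (ltn0Sn (Zp_trunc a).+1).
have chia y : 'chi_i y ^+ (Zp_trunc a).+2 = 1.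
  rewrite -lin_charX ?inE // Zp_cast // (_ : y ^+ a = 1)%g ?lin_char1 //.
  by move/exponentP: expG; apply; rewrite inE.
pose f := [ffun y => sval (prim_rootP prw (chia y)) : 'Z_a].
have fE y : 'chi_i y = w ^+ f y.
  by rewrite ffunE; case: (prim_rootP _ _).
have fh : additive_on f.
  apply/forallP => -[y z] /=; rewrite -val_eqE /=.
  have := eq_prim_root_expr prw (f (y * z)%g) (f y + f z)%N.
  rewrite exprD -!fE lin_charM ?inE // eqxx => /esym.
  by rewrite modn_small.
exists (exist additive_on f fh); apply: contraNneq xi => fx0.
by rewrite cfkerEirr inE lin_char1 // fE (_ : f x = 0) // expr0.
Qed.

End DualGroup.

(** * Orthogonality of characters and annihilators *)

Section ZpExp.
Variables (a : nat) (C : numFieldType) (w : C).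
Hypothesis prw : (Zp_trunc a).+2.-primitive_root w.

Definition zexp (u : 'Z_a) : C := w ^+ u.

Lemma zexpD (u v : 'Z_a) : zexp (u + v) = zexp u * zexp v.
Proof. by rewrite /zexp /= (prim_expr_mod prw) exprD. Qed.

Lemma zexp0 : zexp 0 = 1. Proof. by []. Qed.

Lemma zexp_inj : injective zexp.
Proof.
move=> u v /eqP; rewrite (eq_prim_root_expr prw) !modn_small ?ltn_ord //.
by move/eqP/val_inj.
Qed.

Lemma zexp_sum (I : Type) (s : seq I) (P : pred I) (F : I -> 'Z_a) :
  zexp (\sum_(i <- s | P i) F i) = \prod_(i <- s | P i) zexp (F i).
Proof. by elim/big_rec2: _ => [|i x y _ <-]; rewrite ?zexpD. Qed.

Lemma norm_zexp (u : 'Z_a) : `|zexp u| = 1.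
Proof.
apply/eqP; rewrite -(pexpr_eq1 (n := (Zp_trunc a).+2)) // -normrX /zexp exprAC.
by rewrite (prim_expr_order prw) expr1n normr1.
Qed.

Variable gT : finGroupType.
Hypotheses (a1 : (1 < a)%N) (abG : abelian [set: gT]%SET)
  (expG : (exponent [set: gT]%SET %| a)%N).

Notation dualG := (dual a gT).

(** If x <> 1, translating the sum by some f0 with f0(x) <> 0 multiplies it by a root of unity other
    than 1, so it vanishes. *)
Lemma sum_dual (x : gT) :
  \sum_(f : dualG) zexp (dual_app f x) = #|{: dualG}|%:R * (x == 1%g)%:R.
Proof.
have [->|xn1] := eqVneq x 1%g.
  under eq_bigr => f _ do rewrite dual_app1 zexp0.
  by rewrite sumr_const mulr1.
rewrite mulr0; have [f0 f0x] := dual_separates a1 abG expG xn1.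
set S := \sum_f _; apply/eqP.
have : zexp (dual_app f0 x) * S = S.
  rewrite {2}/S (reindex_inj (@dual_add_inj _ _ f0)) /= mulr_sumr.
  by apply: eq_bigr => f _; rewrite dual_app_add zexpD.
move/eqP; rewrite -subr_eq0 -{2}[S]mul1r -mulrBl mulf_eq0 subr_eq0.
case/orP => // /eqP; rewrite -zexp0 => /zexp_inj /eqP.
by rewrite (negPf f0x).
Qed.

Lemma sum_subgroup (H : {group gT}) (f : dualG) :
  \sum_(x in H) zexp (dual_app f x) =
  #|H|%:R * [forall x in H, dual_app f x == 0]%:R.
Proof.
have [/forall_inP f0|] := boolP [forall x in H, dual_app f x == 0].
  rewrite (eq_bigr (fun=> 1)) ?sumr_const ?mulr1 // => x /f0/eqP ->.
  exact: zexp0.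
case/forallPn => x0; rewrite negb_imply => /andP[x0H f0x]; rewrite mulr0.
set S := \sum_(x in H) _; apply/eqP.
have : zexp (dual_app f x0) * S = S.
  rewrite {2}/S (reindex_inj (mulgI x0)) /= mulr_sumr.
  by apply: eq_big => [x|x _]; rewrite ?groupMl // dual_appM zexpD.
move/eqP; rewrite -subr_eq0 -{2}[S]mul1r -mulrBl mulf_eq0 subr_eq0.
case/orP => // /eqP; rewrite -zexp0 => /zexp_inj /eqP.
by rewrite (negPf f0x).
Qed.

Definition annihilator (H : {set gT}) : {set dualG} :=
  [set f | [forall x in H, dual_app f x == 0]]%SET.

(** Double counting of the sum of zexp(f(x)) over x in H and all f: summing over f first leaves x =
    1, summing over H first leaves the annihilator. *)
Lemma card_annihilator (H : {group gT}) :
  (#|annihilator H| * #|H| = #|{: dualG}|)%N.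
Proof.
apply/eqP; rewrite -(eqr_nat C) natrM; apply/eqP.
have := erefl (\sum_(x in H) \sum_(f : dualG) zexp (dual_app f x)).
rewrite {1}exchange_big /=.
under eq_bigr => f _ do rewrite sum_subgroup.
under [RHS]eq_bigr => x _ do rewrite sum_dual.
rewrite -!mulr_sumr (bigD1 1%g) ?group1 //= eqxx.
rewrite [X in true%:R + X]big1; last first.
  by move=> x /andP[_ /negPf ->].
rewrite addr0 mulr1 mulrC => <-; congr (_ * _).
by rewrite -natr_sum -big_mkcond sum1dep_card.
Qed.

Lemma card_dual : #|{: dualG}| = #|{: gT}|.
Proof.
rewrite -(card_annihilator [set: gT]%G) [X in (X * _)%N](_ : _ = 1%N).
  by rewrite mul1n cardsT.
apply/eqP/cards1P; exists (dual0 a gT); apply/setP => f; rewrite !inE.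
apply/forall_inP/eqP => [h|-> x _]; last by rewrite dual_app0.
by apply: dual_eq => x; rewrite dual_app0; apply/eqP/h; rewrite inE.
Qed.

Definition dual_nz (f : dualG) (x : gT) : bool := dual_app f x != 0.

Lemma dual_nz0 (x : gT) : dual_nz (dual0 a gT) x = false.
Proof. by rewrite /dual_nz dual_app0 eqxx. Qed.

Lemma perp_group_set (S : {set dualG}) : group_set (perp dual_nz S).
Proof.
apply/group_setP; split.
  by rewrite inE; apply/forallP => f; rewrite /dual_nz dual_app1 eqxx implybT.
move=> x y; rewrite !inE => /forallP hx /forallP hy.
apply/forallP => f; apply/implyP => fS; rewrite /dual_nz dual_appM.
move: (hx f) (hy f); rewrite fS /dual_nz !negbK => /eqP-> /eqP->.
by rewrite addr0.
Qed.

(** S lies in the annihilator of the subgroup [perp S]. *)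
Lemma perp_card (S : {set dualG}) :
  (#|S| * #|perp dual_nz S| <= #|{: gT}|)%N.
Proof.
pose H := group (perp_group_set S).
rewrite -card_dual -(card_annihilator H) leq_mul2r; apply/orP; right.
apply/subset_leq_card/fintype.subsetP => f fS; rewrite inE.
apply/forall_inP => x; rewrite inE => /forallP/(_ f).
by rewrite fS /dual_nz negbK.
Qed.

End ZpExp.

(** * Fourier transforms of balanced distributions *)

(** X^n - 1 is separable in characteristic 0, hence has n distinct roots, and a full set of n-th
    roots of unity contains a primitive one. *)
Lemma closed_prim_root_exists (C : numClosedFieldType) (n : nat) :
  (0 < n)%N -> exists w : C, n.-primitive_root w.
Proof.
move=> n0; have [rs rsE] := closed_field_poly_normal ('X^n - 1 : {poly C}).
rewrite (monicP (monicXnsubC _ n0)) scale1r in rsE.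
have roots : all n.-unity_root rs.
  by apply/allP => z; rewrite -root_prod_XsubC -rsE.
have size_rs : (n <= size rs)%N.
  by rewrite -ltnS -(size_prod_XsubC rs id) -rsE size_XnsubC.
have uniq_rs : uniq rs.
  rewrite -separable_prod_XsubC -rsE separable_Xn_sub_1 //.
  by rewrite pnatr_eq0 -lt0n.
have /hasP[w _ prw] := has_prim_root n0 roots uniq_rs size_rs.
by exists w.
Qed.

Lemma normc_le (R : rcfType) (z : R[i]) (r : R) : 0 <= r ->
  complex.Re z ^+ 2 + complex.Im z ^+ 2 <= r ^+ 2 -> `|z| <= r%:C%C.
Proof.
move=> r0 h; rewrite normc_def lecR -[leRHS]ger0_norm // -sqrtr_sqr.
by rewrite ler_wsqrtr.
Qed.

Lemma normc1_sqr (R : rcfType) (z : R[i]) :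
  `|z| = 1 -> complex.Re z ^+ 2 + complex.Im z ^+ 2 = 1.
Proof.
by move=> z1; apply: complexI; rewrite add_Re2_Im2 z1 expr1n.
Qed.

(** The bounded quantity is the real part of e(u) times the conjugate of e(v). On the unit circle it
    equals 1 - |e(u) - e(v)|^2 / 2, and finiteness of T makes the gap uniform. *)
Lemma unit_circle_gap (R : realType) (T : finType) (e : T -> R[i]) :
  injective e -> (forall u, `|e u| = 1) ->
  exists2 d : R, 0 < d <= 1 & forall u v, u != v ->
    complex.Re (e u) * complex.Re (e v) +
    complex.Im (e u) * complex.Im (e v) <= 1 - d.
Proof.
move=> einj e1.
pose D (p : T * T) : R := 1 - (complex.Re (e p.1) * complex.Re (e p.2) +
    complex.Im (e p.1) * complex.Im (e p.2)).
have D0 p : p.1 != p.2 -> 0 < D p.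
  move=> np; have := normc1_sqr (e1 p.1); have := normc1_sqr (e1 p.2).
  have : e p.1 != e p.2 by apply: contra np => /eqP/einj ->.
  rewrite eq_complex /D.
  move: (complex.Re _) (complex.Im _) (complex.Re _) (complex.Im _).
  move=> x1 y1 x2 y2 + h2 h1; rewrite negb_and => /orP nxy.
  have : 0 < (x2 - x1) ^+ 2 + (y2 - y1) ^+ 2.
    case: nxy => n; rewrite -subr_eq0 in n.
      by rewrite ltr_pwDl ?sqr_ge0 // lt0r sqrf_eq0 n sqr_ge0.
    by rewrite ltr_wpDl ?sqr_ge0 // lt0r sqrf_eq0 n sqr_ge0.
  rewrite !expr2 in h1 h2 *; nra.
(* The default value 1 settles the case without distinct pairs and ensures d <= 1. *)
exists (\big[Num.min/1]_(p : T * T | p.1 != p.2) D p).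
  rewrite bigmin_le_id andbT; apply: lt_bigmin => //.
move=> u v uv.
have := @bigmin_le_cond _ _ _ 1 (u, v) (fun p => p.1 != p.2) D uv.
rewrite /D /=; lra.
Qed.

(** The annihilator of c is proper since c <> 0, and in a finite ring it lies in a maximal ideal I.
    Hence u c = v c forces u and v to agree modulo I, which lets balancedness act on the transform
    at c. *)
Lemma maximal_ideal_above (K : finComNzRingType) (c : K) : c != 0 ->
  exists2 I : {set K}, maximal_ideal I & forall u, u * c = 0 -> u \in I.
Proof.
move=> c0; pose A := [set u : K | u * c == 0]%SET.
have idA : `[< @idealr_closed K (mem A) >].
  apply/asboolP; split; first by rewrite inE mul0r.
    by rewrite inE mul1r.
  move=> x u v; rewrite !inE => /eqP hu /eqP hv.
  by rewrite mulrDl -mulrA hu hv mulr0 addr0.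
have [I /maxsetP[/asboolP idI maxI] AI] :=
  @maxset_exists K (fun J => `[< @idealr_closed K (mem J) >]) A idA.
exists I.
  split=> // J idJ IJ; apply: maxI => //; exact/asboolP.
by move=> u uc; apply: (fintype.subsetP AI); rewrite inE uc.
Qed.

(** The squared modulus is the average of Re(zexp(u c) conj(zexp(v c))) over independent u and v.
    Pairs with u c <> v c lose d; for fixed u the remaining v lie in one class modulo a maximal
    ideal, of mass at most 1 - eps. So the square is at most 1 - d eps. *)
Lemma balanced_fourier_bound (R : realType) (a : nat) (w : R[i]) (eps : R) :
  (Zp_trunc a).+2.-primitive_root w -> 0 < eps < 1 ->
  exists2 r : R, 0 < r < 1 &
  forall mu : 'Z_a -> R, (forall u, 0 <= mu u) -> \sum_u mu u = 1 ->
    (forall I : {set 'Z_a}, maximal_ideal I ->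
       forall s, \sum_(u | u - s \in I) mu u <= 1 - eps) ->
    forall c, c != 0 -> `|\sum_u (mu u)%:C%C * zexp w (u * c)| <= r%:C%C.
Proof.
move=> prw /andP[eps0 eps1].
have [d /andP[d0 d1] gap] := unit_circle_gap (zexp_inj prw) (norm_zexp prw).
(* The square of this value is at least 1 - d eps, which avoids a square root. *)
exists (1 - d * eps / 2) => [|mu mu0 mu1 hmu c c0]; first by nra.
apply: normc_le; first by nra.
pose x u := complex.Re (zexp w (u * c)); pose y u := complex.Im (zexp w (u * c)).
have ReE : complex.Re (\sum_u (mu u)%:C%C * zexp w (u * c)) = \sum_u mu u * x u.
  rewrite -[LHS]/((@complex.Re R : Rcomplex R -> R) _) raddf_sum.
  apply: eq_bigr => u _; rewrite /x; case: (zexp _ _) => p q /=; ring.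
have ImE : complex.Im (\sum_u (mu u)%:C%C * zexp w (u * c)) = \sum_u mu u * y u.
  rewrite -[LHS]/((@complex.Im R : Rcomplex R -> R) _) raddf_sum.
  apply: eq_bigr => u _; rewrite /y; case: (zexp _ _) => p q /=; ring.
rewrite ReE ImE.
have [I maxI annI] := maximal_ideal_above c0.
have row u : \sum_v mu v * (x u * x v + y u * y v) <= 1 - d * eps.
  apply: (@le_trans _ _ (\sum_v mu v * (1 - d * (u * c != v * c)%:R))).
    apply: ler_sum => v _; rewrite ler_wpM2l // /x /y.
    have [<-|uv] := eqVneq (u * c) (v * c); last by rewrite mulr1 gap.
    by rewrite mulr0 subr0 -!expr2 (normc1_sqr (norm_zexp prw _)).
  have -> : \sum_v mu v * (1 - d * (u * c != v * c)%:R) =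
     1 - d * (1 - \sum_(v | u * c == v * c) mu v).
    rewrite -[X in _ = X - _]mu1 -[X in d * (X - _)]mu1.
    rewrite [X in d * (X - _)](bigID (fun v => u * c == v * c)) /=.
    rewrite addrAC subrr add0r [X in d * X]big_mkcond mulr_sumr -sumrB.
    apply: eq_bigr => v _; case: (u * c == v * c) => /=; ring.
  suff : \sum_(v | u * c == v * c) mu v <= 1 - eps by nra.
  apply: le_trans (hmu I maxI u); rewrite big_mkcond [leRHS]big_mkcond /=.
  apply: ler_sum => v _; case: eqP => [uv|_]; last by case: ifP.
  by rewrite annI // mulrBl uv subrr.
apply: (@le_trans _ _ (1 - d * eps)); last by have := sqr_ge0 (d * eps); nra.
have -> : (\sum_u mu u * x u) ^+ 2 + (\sum_u mu u * y u) ^+ 2 =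
    \sum_u mu u * \sum_v mu v * (x u * x v + y u * y v).
  rewrite !expr2 !mulr_suml -big_split /=; apply: eq_bigr => u _.
  rewrite !mulr_sumr -big_split /=; apply: eq_bigr => v _; ring.
apply: (@le_trans _ _ (\sum_u mu u * (1 - d * eps))).
  by apply: ler_sum => u _; rewrite ler_wpM2l.
by rewrite -mulr_suml mu1 mul1r.
Qed.

(** * Surjections from a cokernel *)

Section SurCount.
Variables (a : nat) (gT : finGroupType).
Hypotheses (a1 : (1 < a)%N) (abG : abelian [set: gT]%SET)
  (expG : (exponent [set: gT]%SET %| a)%N).

Let commG (x y : gT) : commute x y.
Proof. by apply: (centsP abG); rewrite inE. Qed.

Let expG1 (x : gT) : (x ^+ (Zp_trunc a).+2 = 1)%g.
Proof. by rewrite Zp_cast //; move/exponentP: expG; apply; rewrite inE. Qed.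

(** The homomorphism (Z/a)^n -> G with values g i on the standard basis. Exponents are the natural
    representatives of the coordinates, which is consistent because the exponent of G divides a. *)
Definition eval_cV (n : nat) (g : 'I_n -> gT) (v : 'cV['Z_a]_n) : gT :=
  (\prod_i g i ^+ v i 0%R)%g.

Lemma eval_cVD (n : nat) (g : 'I_n -> gT) (u v : 'cV['Z_a]_n) :
  eval_cV g (u + v) = (eval_cV g u * eval_cV g v)%g.
Proof.
rewrite /eval_cV; elim/big_rec3: _ => [|i x y z _ ->]; first by rewrite mulg1.
rewrite mxE /= expg_mod // expgD -!mulgA; congr (_ * _)%g.
by rewrite !mulgA; congr (_ * _)%g; apply: commG.
Qed.

Lemma eval_cV0 (n : nat) (g : 'I_n -> gT) : eval_cV g 0 = 1%g.
Proof. by apply: (mulgI (eval_cV g 0)); rewrite -eval_cVD addr0 mulg1. Qed.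

Lemma eval_cVMn (n : nat) (g : 'I_n -> gT) (v : 'cV['Z_a]_n) (m : nat) :
  eval_cV g (v *+ m) = (eval_cV g v ^+ m)%g.
Proof.
by elim: m => [|m IH]; rewrite ?eval_cV0 // mulrS eval_cVD IH expgS.
Qed.

Lemma eval_cV_delta (n : nat) (g : 'I_n -> gT) (i : 'I_n) :
  eval_cV g (delta_mx i 0) = g i.
Proof.
rewrite /eval_cV (eq_bigr (fun j => if j == i then g j else 1%g)).
  by rewrite -big_mkcond big_pred1_eq.
by move=> j _; rewrite mxE eqxx andbT; case: eqP.
Qed.

Lemma scale_Zp (n : nat) (c : 'Z_a) (v : 'cV['Z_a]_n) : c *: v = v *+ c.
Proof. by rewrite -{1}[c]natr_Zp scaler_nat. Qed.

Lemma mulmx_sum_col (m n : nat) (A : 'M['Z_a]_(m, n)) (x : 'cV['Z_a]_n) :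
  A *m x = \sum_j col j A *+ x j 0.
Proof.
apply/matrixP => i k; rewrite ord1 mxE summxE; apply: eq_bigr => j _.
by rewrite -scale_Zp !mxE mulrC.
Qed.

Lemma cV_sum_delta (n : nat) (v : 'cV['Z_a]_n) :
  v = \sum_i delta_mx i 0 *+ v i 0.
Proof.
rewrite {1}(matrix_sum_delta v); apply: eq_bigr => i _.
by rewrite big_ord1 scale_Zp.
Qed.

Definition kills_columns (n : nat) (A : 'M['Z_a]_n) (g : 'I_n -> gT) : bool :=
  [forall j, eval_cV g (col j A) == 1%g].

Definition generates (n : nat) (g : 'I_n -> gT) : bool :=
  << [set g i | i : 'I_n]%SET >>%g == [set: gT]%SET.

Lemma eval_cV_sum (n : nat) (g : 'I_n -> gT) (I : Type) (s : seq I)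
    (F : I -> 'cV['Z_a]_n) :
  eval_cV g (\sum_(i <- s) F i) = (\prod_(i <- s) eval_cV g (F i))%g.
Proof.
by elim/big_rec2: _ => [|i x y _ <-]; rewrite ?eval_cV0 ?eval_cVD.
Qed.

Lemma eval_cV_colspace (n : nat) (A : 'M['Z_a]_n) (g : 'I_n -> gT) v :
  kills_columns A g -> v \in colspace A -> eval_cV g v = 1%g.
Proof.
move=> /forallP h /imsetP[x _ ->]; rewrite mulmx_sum_col eval_cV_sum.
by rewrite big1 // => j _; rewrite eval_cVMn (eqP (h j)) expg1n.
Qed.

(** A homomorphism from the cokernel is determined by the images of the basis vectors. Conversely
    [eval_cV g] descends to the quotient when g kills the columns, and it is onto when g
    generates. *)
Lemma card_Sur (n : nat) (A : 'M['Z_a]_n) :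
  #|Sur (cok A) gT| =
  #|[set g : {ffun 'I_n -> gT} | generates g && kills_columns A g]%SET|.
Proof.
pose H := colspace_group A.
(* The ambient group is abelian, so [coset H] is multiplicative everywhere. *)
have nH v : v \in 'N(H)%g.
  apply/normP; apply/setP => x; rewrite mem_conjg.
  by rewrite [(x ^ _)%g](_ : _ = - - v + (x - v)) // opprK addrC subrK.
have cosD u v : coset H (u + v) = (coset H u * coset H v)%g by rewrite -morphM.
pose phi (f : {ffun cok A -> gT}) : {ffun 'I_n -> gT} :=
  [ffun i => f (coset H (delta_mx i 0))].
have fE f v : f \in Sur (cok A) gT -> f (coset H v) = eval_cV (phi f) v.
  rewrite inE => /andP[/morphicP fM _].
  have fM' x y : f (x * y)%g = (f x * f y)%g by apply: fM; rewrite inE.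
  have f1 : f 1%g = 1%g by apply: (mulgI (f 1%g)); rewrite -fM' !mulg1.
  have fcD x y : f (coset H (x + y)) = (f (coset H x) * f (coset H y))%g.
    by rewrite cosD fM'.
  have fc0 : f (coset H 0) = 1%g.
    by apply: (mulgI (f (coset H 0))); rewrite -fcD addr0 mulg1.
  have fcMn x m : f (coset H (x *+ m)) = (f (coset H x) ^+ m)%g.
    by elim: m => [|m IH]; rewrite ?fc0 // mulrS fcD IH expgS.
  rewrite {1}(cV_sum_delta v) /eval_cV.
  elim/big_rec2: _ => [|i x y _ <-]; first exact: fc0.
  by rewrite fcD fcMn ffunE.
rewrite -(@card_in_imset _ _ phi); last first.
  move=> f1 f2 f1S f2S eqp; apply/ffunP => x.
  by rewrite -(coset_reprK x) !fE // eqp.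
apply: eq_card => g; apply/imsetP/idP => [[f fS ->]|].
  rewrite inE; apply/andP; split.
    rewrite /generates finset.eqEsubset finset.subsetT /=.
    apply/fintype.subsetP => y _.
    move: (fS); rewrite inE => /andP[_ /forallP/(_ y)/existsP[x /eqP <-]].
    rewrite -(coset_reprK x) fE // /eval_cV group_prod // => i _.
    by rewrite groupX // mem_gen // finset.imset_f.
  apply/forallP => j; rewrite -fE //; apply/eqP.
  have -> : coset H (col j A) = 1%g.
    apply: coset_id; apply/imsetP; exists (delta_mx j 0) => //.
    by rewrite colE.
  move: fS; rewrite inE => /andP[/morphicP fM _].
  by apply: (mulgI (f 1%g)); rewrite -fM ?inE // !mulg1.
rewrite inE => /andP[gen kil].
(* f evaluates on a chosen lift; [fc] shows independence of the lift, as two lifts differ by an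
   element of the column space. *)
pose f : {ffun cok A -> gT} := [ffun x => eval_cV g (repr (x : coset_of H))].
have fc v : f (coset H v) = eval_cV g v.
  rewrite ffunE.
  have : repr (coset H v) \in (H :* v)%g.
    by rewrite -val_coset // mem_repr_coset.
  case/rcosetP => h hH ->; rewrite [(h * v)%g](_ : _ = h + v) // eval_cVD.
  by rewrite (eval_cV_colspace kil) ?mul1g.
have fS : f \in Sur (cok A) gT.
  rewrite inE; apply/andP; split.
    apply/morphicP => x y _ _.
    by rewrite -(coset_reprK x) -(coset_reprK y) -cosD !fc eval_cVD.
  apply/forallP => y.
  have : y \in << [set g i | i : 'I_n]%SET >>%g by rewrite (eqP gen) inE.
  have gs : group_set [set eval_cV g v | v : 'cV['Z_a]_n]%SET.
    apply/group_setP; split.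
      by apply/imsetP; exists 0; rewrite ?eval_cV0.
    move=> _ _ /imsetP[u _ ->] /imsetP[v _ ->].
    by apply/imsetP; exists (u + v); rewrite ?eval_cVD.
  have sub : (<< [set g i | i : 'I_n]%SET >> \subset group gs)%g.
    rewrite gen_subG; apply/fintype.subsetP => _ /imsetP[i _ ->].
    by apply/imsetP; exists (delta_mx i 0); rewrite ?eval_cV_delta.
  move/(fintype.subsetP sub) => /imsetP[v _ ->].
  by apply/existsP; exists (coset H v); rewrite fc.
exists f => //; apply/ffunP => i; rewrite ffunE.
by rewrite fc eval_cV_delta.
Qed.

(** If f killed every g i, its kernel would be all of G. This is the form of generation that
    [energy_sum_bound] expects. *)
Lemma generates_separates (n : nat) (g : 'I_n -> gT) : generates g ->
  [forall f : dual a gT, (f != dual0 a gT) ==> [exists i, dual_nz f (g i)]].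
Proof.
move=> gen; apply/forallP => f; apply/implyP; apply: contraR => /existsPn h.
apply/eqP/dual_eq => x; rewrite dual_app0; apply/eqP.
have : x \in << [set g i | i : 'I_n]%SET >>%g by rewrite (eqP gen) inE.
have sub : (<< [set g i | i : 'I_n]%SET >> \subset
    group (perp_group_set [set f]%SET))%g.
  rewrite gen_subG; apply/fintype.subsetP => _ /imsetP[i _ ->].
  by rewrite inE; apply/forallP => f'; apply/implyP; rewrite inE => /eqP ->.
move/(fintype.subsetP sub); rewrite inE => /forallP/(_ f).
by rewrite inE eqxx /dual_nz negbK.
Qed.

(** A family that does not generate lies in a proper subgroup, which has at most half of the
    elements; take the union bound over subgroups. *)
Lemma card_generates (R : realFieldType) (n : nat) :
  1 - #|{group gT}|%:R * (1 / 2) ^+ n <=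
  (#|{: gT}|%:R^-1 ^+ n : R) *
    #|[set g : {ffun 'I_n -> gT} | generates g]%SET|%:R <= 1.
Proof.
set G := [set g : {ffun 'I_n -> gT} | generates g]%SET.
have N0 : 0 < #|{: gT}|%:R :> R.
  by rewrite ltr0n; apply/card_gt0P; exists 1%g.
have cT : (#|G| + #|~: G| = #|{: gT}| ^ n)%N.
  by rewrite cardsC card_ffun card_ord.
have cTR : #|G|%:R + #|~: G|%:R = #|{: gT}|%:R ^+ n :> R.
  by rewrite -natrD cT natrX.
have cC : #|~: G|%:R <= #|{group gT}|%:R * (#|{: gT}|%:R / 2) ^+ n :> R.
  apply: (@le_trans _ _ (\sum_(H : {group gT} | H != [set: gT]%G)
     #|[set g : {ffun 'I_n -> gT} | [forall i, g i \in H]]%SET|%:R)).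
    rewrite -natr_sum ler_nat.
    apply: (@leq_trans #|\bigcup_(H : {group gT} | H != [set: gT]%G)
        [set g : {ffun 'I_n -> gT} | [forall i, g i \in H]]|%SET).
      apply/subset_leq_card/fintype.subsetP => g; rewrite !inE => ng.
      apply/bigcupP; exists <<[set g i | i : 'I_n]%SET>>%G => //.
      by rewrite inE; apply/forallP => i; rewrite mem_gen // finset.imset_f.
    apply: (big_ind2 (fun (B : {set {ffun 'I_n -> gT}}) k => #|B| <= k)%N) => //.
      by rewrite cards0.
    move=> B1 k1 B2 k2 h1 h2; apply: leq_trans (leq_add h1 h2).
    by rewrite cardsU leq_subr.
  apply: (@le_trans _ _ (\sum_(H : {group gT} | H != [set: gT]%G)
     (#|{: gT}|%:R / 2) ^+ n)).
    apply: ler_sum => H Hn.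
    have -> : #|[set g : {ffun 'I_n -> gT} | [forall i, g i \in H]]%SET| =
        (#|H| ^ n)%N.
      rewrite -[n in RHS]card_ord -card_ffun_on; apply: eq_card => g.
      by rewrite inE; apply/forallP/ffun_onP.
    rewrite natrX; apply: lerXn2r; rewrite ?qualifE /= ?divr_ge0 ?(ltW N0) //.
    rewrite ler_pdivlMr // -natrM ler_nat -cardsT -(Lagrange (finset.subsetT H)).
    rewrite leq_mul2l; apply/orP; right.
    rewrite ltnNge; apply: contra Hn => idx.
    rewrite -val_eqE /= eqEcard finset.subsetT /=.
    rewrite -(Lagrange (finset.subsetT H)).
    by rewrite -[leqRHS]muln1 leq_mul2l idx orbT.
  rewrite sumr_const -[leLHS]mulr_natl ler_wpM2r ?exprn_ge0 ?divr_ge0 ?(ltW N0) //.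
  by rewrite ler_nat max_card.
rewrite exprVn; set M := _ ^+ n in cTR *.
have M0 : 0 < M by rewrite exprn_gt0.
rewrite ler_pdivlMl // ler_pdivrMl // mulr1; apply/andP; split; last first.
  by rewrite -cTR lerDl.
rewrite exprMn in cC; rewrite div1r mulrBr mulr1 -cTR.
rewrite -[X in _ <= X](addrK (#|~: G|%:R)) lerD2l lerN2 cTR.
by apply: (le_trans cC); rewrite mulrCA.
Qed.
End SurCount.

Lemma sum_matrix_prod (S : comPzRingType) (K : finType) (m n : nat)
    (F : 'I_m -> 'I_n -> K -> S) :
  \sum_(A : 'M[K]_(m, n)) \prod_j \prod_i F i j (A i j) =
  \prod_j \prod_i \sum_u F i j u.
Proof.
rewrite pair_bigA /= bigA_distr_bigA /=.
rewrite (reindex (fun f : {ffun 'I_n * 'I_m -> K} => \matrix_(i, j) f (j, i))) /=.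
  apply: eq_bigr => f _; rewrite pair_bigA; apply: eq_bigr => -[j i] _.
  by rewrite mxE.
exists (fun A : 'M[K]_(m, n) => [ffun p => A p.2 p.1]) => [f _|A _].
  by apply/ffunP => -[j i]; rewrite ffunE mxE.
by apply/matrixP => i j; rewrite mxE ffunE.
Qed.

Lemma normc_real (R : rcfType) (x : R) : `|x%:C%C| = `|x|%:C%C.
Proof. by rewrite normc_def /= expr0n addr0 sqrtr_sqr. Qed.

(** * Fourier expansion of the expected number of surjections *)

Section Fourier.
Variables (R : realType) (a : nat) (gT : finGroupType) (w : R[i]).
Hypotheses (a1 : (1 < a)%N) (abG : abelian [set: gT]%SET)
  (expG : (exponent [set: gT]%SET %| a)%N)
  (prw : (Zp_trunc a).+2.-primitive_root w).

Local Notation N := (#|{: gT}|).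

(** By orthogonality the indicator that one column is killed is an average over characters; the
    product over columns becomes a sum over families h. *)
Lemma kills_columns_fourier (n : nat) (A : 'M['Z_a]_n) (g : 'I_n -> gT) :
  (kills_columns A g)%:R = (N%:R^-1) ^+ n *
    \sum_(h : {ffun 'I_n -> dual a gT})
      \prod_j \prod_i zexp w (A i j * dual_app (h j) (g i)) :> R[i].
Proof.
have N0 : N%:R != 0 :> R[i].
  by rewrite pnatr_eq0 -lt0n; apply/card_gt0P; exists 1%g.
have -> : (kills_columns A g)%:R =
    \prod_j ((eval_cV g (col j A) == 1%g)%:R : R[i]).
  have [/forallP h|/forallPn[j /negPf hj]] := boolP (kills_columns A g).
    by rewrite big1 // => j _; rewrite h.
  by rewrite (bigD1 j) //= hj mul0r.
rewrite -[X in _ ^+ X]card_ord -prodr_const.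
rewrite -(bigA_distr_bigA (fun j f => \prod_i zexp w (A i j * dual_app f (g i)))).
rewrite -big_split /=; apply: eq_bigr => j _.
rewrite (eq_bigr (fun f : dual a gT => zexp w (dual_app f (eval_cV g (col j A))))).
  by rewrite (sum_dual prw a1 abG expG) (card_dual prw) // mulKf.
move=> f _; rewrite dual_app_prod zexp_sum //; apply: eq_bigr => i _.
by rewrite dual_appX mxE -mulr_natl natr_Zp.
Qed.

Variables (n : nat) (mu : 'I_n -> 'I_n -> 'Z_a -> R).

Definition expected_Sur : R :=
  \sum_(A : 'M['Z_a]_n) (\prod_j \prod_i mu i j (A i j)) *
     #|Sur (cok A) gT|%:R.

Definition mu_hat (i j : 'I_n) (c : 'Z_a) : R[i] :=
  \sum_u (mu i j u)%:C%C * zexp w (u * c).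

Lemma expected_Sur_fourier :
  expected_Sur%:C%C = (N%:R^-1) ^+ n *
    \sum_(g : {ffun 'I_n -> gT} | generates g)
    \sum_(h : {ffun 'I_n -> dual a gT})
      \prod_j \prod_i mu_hat i j (dual_app (h j) (g i)).
Proof.
rewrite /expected_Sur rmorph_sum /=.
transitivity (\sum_(A : 'M['Z_a]_n) \sum_(g : {ffun 'I_n -> gT} | generates g)
    (\prod_j \prod_i (mu i j (A i j))%:C%C) * (kills_columns A g)%:R).
  apply: eq_bigr => A _; rewrite rmorphM /= rmorph_prod -mulr_sumr; congr (_ * _).
    by apply: eq_bigr => j _; rewrite rmorph_prod.
  rewrite rmorph_nat (card_Sur a1 abG expG) -natr_sum; congr (_%:R).
  by rewrite -big_mkcondr /= sum1dep_card.
rewrite exchange_big /= mulr_sumr; apply: eq_bigr => g _.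
under eq_bigr => A _ do rewrite kills_columns_fourier mulrCA mulr_sumr.
rewrite -mulr_sumr exchange_big /=; congr (_ * _); apply: eq_bigr => h _.
rewrite -(sum_matrix_prod (fun i j u =>
   (mu i j u)%:C%C * zexp w (u * dual_app (h j) (g i)))).
apply: eq_bigr => A _; rewrite -big_split; apply: eq_bigr => j _.
by rewrite -big_split.
Qed.

Hypotheses (mu_ge0 : forall i j u, 0 <= mu i j u)
  (mu_sum1 : forall i j, \sum_u mu i j u = 1).

Lemma mu_hat0 (i j : 'I_n) : mu_hat i j 0 = 1.
Proof.
rewrite /mu_hat; under eq_bigr => u _ do rewrite mulr0 zexp0 mulr1.
by rewrite -rmorph_sum /= mu_sum1.
Qed.

Lemma norm_mu_hat_le1 (i j : 'I_n) (c : 'Z_a) : `|mu_hat i j c| <= 1.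
Proof.
apply: (le_trans (ler_norm_sum _ _ _)).
under eq_bigr => u _ do rewrite normrM norm_zexp // mulr1 normc_real ger0_norm //.
by rewrite -rmorph_sum /= mu_sum1.
Qed.

(** The subtracted term is the contribution of h = 0, where all transforms equal 1. For other h,
    each allowed position with h_j(g_i) <> 0 gives a factor at most r and every remaining position a
    factor at most 1. *)
Lemma expected_Sur_bound (L : finType) (labr labc : 'I_n -> L) (c0 : L) (r : R) :
  0 < r < 1 ->
  (forall i j, allowed labr labc c0 i j ->
     forall c, c != 0 -> `|mu_hat i j c| <= r%:C%C) ->
  `|expected_Sur - N%:R^-1 ^+ n *
      #|[set g : {ffun 'I_n -> gT} | generates g]%SET|%:R| <=
  N%:R^-1 ^+ n *
  (\sum_(g : {ffun 'I_n -> gT} |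
       [forall f : dual a gT, (f != dual0 a gT) ==> [exists i, dual_nz f (g i)]])
   \sum_(h : {ffun 'I_n -> dual a gT} | h != [ffun=> dual0 a gT])
     \prod_j r ^+ col_energy (@dual_nz a gT) labr labc c0 g h j).
Proof.
move=> /andP[r0 r1] hr; rewrite -lecR -normc_real rmorphB /= expected_Sur_fourier.
have NC : (N%:R^-1 ^+ n)%:C%C = N%:R^-1 ^+ n :> R[i].
  by rewrite rmorphXn /= fmorphV rmorph_nat.
have -> : (N%:R^-1 ^+ n * #|[set g : {ffun 'I_n -> gT} | generates g]%SET|%:R)%:C%C =
  N%:R^-1 ^+ n * \sum_(g : {ffun 'I_n -> gT} | generates g) 1 :> R[i].
  by rewrite rmorphM /= NC rmorph_nat sumr_const cardsE.
rewrite -mulrBr -sumrB normrM ger0_norm ?exprn_ge0 ?invr_ge0 //.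
rewrite rmorphM /= NC ler_wpM2l ?exprn_ge0 ?invr_ge0 //.
apply: (le_trans (ler_norm_sum _ _ _)); rewrite rmorph_sum /=.
rewrite [leLHS]big_mkcond [leRHS]big_mkcond /=; apply: ler_sum => g _.
have rhs0 : 0 <= (\sum_(h : {ffun 'I_n -> dual a gT} | h != [ffun=> dual0 a gT])
     \prod_j r ^+ col_energy (@dual_nz a gT) labr labc c0 g h j)%:C%C.
  rewrite ler0c sumr_ge0 // => h _; rewrite prodr_ge0 // => j _.
  by rewrite exprn_ge0 // ltW.
case: ifP => [gen|_]; last by case: ifP.
rewrite generates_separates // (bigD1 [ffun=> dual0 a gT]) //=.
rewrite big1 => [|j _]; last first.
  by rewrite big1 // => i _; rewrite ffunE dual_app0 mu_hat0.
rewrite addrAC subrr add0r; apply: (le_trans (ler_norm_sum _ _ _)).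
rewrite rmorph_sum /=; apply: ler_sum => h _.
rewrite normr_prod rmorph_prod; apply: ler_prod => j _; rewrite normr_ge0 /=.
rewrite normr_prod /col_energy -[leRHS]/((_ : R)%:C%C).
have -> : #|[set i | allowed labr labc c0 i j && dual_nz (h j) (g i)]%SET| =
   (\sum_i (allowed labr labc c0 i j && dual_nz (h j) (g i)))%N.
  by rewrite -big_mkcond sum1dep_card.
rewrite -prodrXr rmorph_prod; apply: ler_prod => i _; rewrite normr_ge0 /=.
have [/andP[al nzi]|_] := boolP (allowed labr labc c0 i j && dual_nz (h j) (g i)).
  by rewrite expr1 hr.
by rewrite expr0 norm_mu_hat_le1.
Qed.
End Fourier.

(** * Random matrices *)

Local Open Scope classical_set_scope.

Section FiniteRV.
Context (R : realType) (d : measure_display) (T : measurableType d).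
Variables (P : probability T R) (V : finType) (X : T -> V).
Hypothesis mX : forall v, measurable (X @^-1` [set v]).

Definition point_mass (v : V) : R := fine (P (X @^-1` [set v])).

Lemma point_massE (v : V) : P (X @^-1` [set v]) = (point_mass v)%:E.
Proof. by rewrite /point_mass fineK // fin_num_measure. Qed.

Lemma point_mass_ge0 (v : V) : 0 <= point_mass v.
Proof. by rewrite fine_ge0. Qed.

Lemma expectation_point_mass (f : V -> R) : (forall v, 0 <= f v) ->
  ('E_P[fun w => f (X w)] = (\sum_v point_mass v * f v)%:E)%E.
Proof.
move=> f0; rewrite unlock.
transitivity (\int[P]_w (\sum_(v : V) (f v)%:E *
    (\1_(X @^-1` [set v]) w)%:E))%E.
  apply: eq_integral => w _; rewrite (bigD1 (X w)) //= big1.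
    by rewrite indicE mem_set // mule1 adde0.
  by move=> v vX; rewrite indicE memNset ?mule0 // => /= h; rewrite h eqxx in vX.
rewrite ge0_integral_sum //.
- rewrite -sumEFin; apply: eq_bigr => v _.
  rewrite ge0_integralZl_EFin //; last first.
    apply/measurable_realfun.measurable_EFinP.
    exact: measurable_realfun.measurable_indic.
  rewrite integral_indic // setIT [X in (_ * X)%E](_ : _ = (point_mass v)%:E).
    by rewrite -EFinM mulrC.
  exact: point_massE.
- move=> v; apply: measurable_funeM.
  apply/measurable_realfun.measurable_EFinP.
  exact: measurable_realfun.measurable_indic.
- by move=> v w _; rewrite mule_ge0 // lee_fin.
Qed.

Lemma sum_point_mass : \sum_v point_mass v = 1.
Proof.
have := expectation_point_mass (fun=> ler01).
rewrite -[X in 'E_P[X]%E]/(cst 1) expectation_cst => -[->].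
by apply: eq_bigr => v _; rewrite mulr1.
Qed.

Lemma sum_point_mass_pred (B : pred V) : measurable [set w | B (X w)] ->
  ((\sum_(v | B v) point_mass v)%:E = P [set w | B (X w)])%E.
Proof.
move=> mB; rewrite -expectation_indic //.
rewrite [X in 'E_P[X]%E](_ : _ = fun w => (B (X w))%:R).
  rewrite (@expectation_point_mass (fun v => (B v)%:R)) => [|v]; last exact: ler0n.
  congr (_%:E); rewrite big_mkcond; apply: eq_bigr => v _.
  by case: (B v); rewrite ?mulr1 ?mulr0.
apply/funext => w; rewrite indicE; congr (_%:R); congr nat_of_bool.
by apply/idP/idP => [/set_mem|/mem_set].
Qed.
End FiniteRV.

(** * The law of a matrix with stairs of zeros *)

Section StairsMatrix.
Context (R : realType) (d : measure_display) (T : measurableType d).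
Variables (P : probability T R) (a : nat) (eps : R) (k n : nat).
Variables (alpha beta : 'I_k -> nat) (M : T -> 'M['Z_a]_n).
Hypothesis hM : balanced_stairs P eps alpha beta M.

Let entry (i j : 'I_n) (w : T) : 'Z_a := M w i j.

Lemma entry_stairs (i j : 'I_n) (u : 'Z_a) : in_stairs alpha beta (i, j) ->
  entry i j @^-1` [set u] = if u == 0 then setT else set0.
Proof.
case: hM => h0 _ _ st; have e0 w : entry i j w = 0 := h0 (i, j) w st.
apply/seteqP; split=> w /=; first by rewrite e0 => <-; rewrite eqxx.
by case: eqP => // ->.
Qed.

Lemma measurable_entry (i j : 'I_n) (u : 'Z_a) :
  measurable (entry i j @^-1` [set u]).
Proof.
have [st|nst] := boolP (in_stairs alpha beta (i, j)).
  by rewrite entry_stairs //; case: ifP.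
by case: hM => _ /(_ (i, j) nst) [+ _] _; apply.
Qed.

Definition entry_pmf (i j : 'I_n) : 'Z_a -> R := point_mass P (entry i j).

Lemma entry_pmf_stairs (i j : 'I_n) (u : 'Z_a) :
  in_stairs alpha beta (i, j) -> entry_pmf i j u = (u == 0)%:R.
Proof.
move=> st; rewrite /entry_pmf /point_mass entry_stairs //.
by case: ifP => _; rewrite ?probability_setT ?measure0.
Qed.

Lemma entry_pmf_balanced (i j : 'I_n) (I : {set 'Z_a}) (s : 'Z_a) :
  ~~ in_stairs alpha beta (i, j) -> maximal_ideal I ->
  \sum_(u | u - s \in I) entry_pmf i j u <= 1 - eps.
Proof.
move=> nst maxI; case: hM => _ /(_ (i, j) nst) [mX bal] _.
rewrite -lee_fin (sum_point_mass_pred P (measurable_entry i j)).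
  exact: (bal I maxI s).
exact: (mX [set u | u - s \in I]).
Qed.

Lemma matrix_preimage (A : 'M['Z_a]_n) :
  M @^-1` [set A] =
  \bigcap_(p in [set` [set: 'I_n * 'I_n]%SET]) (entry p.1 p.2 @^-1` [set A p.1 p.2]).
Proof.
apply/seteqP; split=> [w /= <- p _ //|w h]; apply/matrixP => i j.
by apply: (h (i, j)) => /=; rewrite inE.
Qed.

Lemma measurable_matrix (A : 'M['Z_a]_n) : measurable (M @^-1` [set A]).
Proof.
rewrite matrix_preimage; apply: fin_bigcap_measurable => [|p _].
  exact: finite_finset.
exact: measurable_entry.
Qed.

(** Independence concerns only the positions outside the stairs. If A is nonzero somewhere in the
    stairs, both sides vanish; otherwise the stairs impose no condition and contribute factors 1. *)
Lemma matrix_pmf (A : 'M['Z_a]_n) :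
  point_mass P M A = \prod_j \prod_i entry_pmf i j (A i j).
Proof.
rewrite exchange_big pair_bigA /=.
have [/existsP[p /andP[st An0]]|/existsPn h] := boolP
    [exists p : 'I_n * 'I_n, in_stairs alpha beta p && (A p.1 p.2 != 0)].
  rewrite (bigD1 p) //= entry_pmf_stairs -?surjective_pairing //.
  rewrite (negPf An0) mul0r /point_mass (_ : M @^-1` [set A] = set0) ?measure0 //.
  apply/seteqP; split=> // w /= MA.
  by case: hM => h0 _ _; have := h0 p w st; rewrite MA => /eqP; apply/negP.
pose J := [set p : 'I_n * 'I_n | ~~ in_stairs alpha beta p]%SET.
have -> : \prod_(p : 'I_n * 'I_n) entry_pmf p.1 p.2 (A p.1 p.2) =
    \prod_(p in J) entry_pmf p.1 p.2 (A p.1 p.2).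
  rewrite (bigID (mem J)) /= [X in _ * X]big1 ?mulr1 // => -[i j].
  rewrite inE negbK => st; rewrite entry_pmf_stairs //.
  by have := h (i, j); rewrite st /= negbK => /eqP ->; rewrite eqxx.
apply: EFin_inj; rewrite -(point_massE P measurable_matrix).
have -> : M @^-1` [set A] =
    \bigcap_(p in [set` J]) (entry p.1 p.2 @^-1` [set A p.1 p.2]).
  rewrite matrix_preimage; apply/seteqP; split=> w hw p pJ.
    by apply: hw => /=; rewrite inE.
  have [st|nst] := boolP (in_stairs alpha beta p); last first.
    by apply: hw => /=; rewrite inE.
  have := h p; rewrite st /= negbK => /eqP ->.
  by case: hM => h0 _ _; apply: h0.
case: hM => _ _ /(_ J (fun p => [set A p.1 p.2])) ->.
  elim/big_rec2: _ => // p x y _ ->; rewrite EFinM; congr (_ * _)%E.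
  exact: (point_massE P (measurable_entry p.1 p.2)).
by apply/fintype.subsetP => p; rewrite !inE.
Qed.

Lemma expectation_stairs (gT : finGroupType) :
  ('E_P[fun w => #|Sur (cok (M w)) gT|%:R] =
   (expected_Sur gT entry_pmf)%:E)%E.
Proof.
rewrite (@expectation_point_mass _ _ _ P _ _ measurable_matrix
  (fun A => #|Sur (cok A) gT|%:R)) //.
by congr (_%:E); apply: eq_bigr => A _; rewrite matrix_pmf.
Qed.

End StairsMatrix.

(* Row i of the upper part and its mirror column m-1-i receive the same label,
   which changes exactly at the thresholds alpha l; the last w rows and columns
   are unlabelled. *)
Lemma stair_labels (k n w : nat) (alpha beta : 'I_k -> nat) :
  (w <= n)%N -> (forall l, (alpha l + beta l + w <= n)%N) ->
  exists labr labc : 'I_n -> option 'I_k.+1,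
  [/\ forall c, #|fibre labr c| = #|fibre labc c|,
      (w <= #|fibre labr None|)%N &
      forall i j, allowed labr labc None i j -> ~~ in_stairs alpha beta (i, j)].
Proof.
move=> wn hab; pose m := (n - w)%N.
pose level (i : nat) := #|[set l | (i < alpha l)%N]%SET|.
have level_le i : (level i < k.+1)%N.
  by rewrite ltnS -[k in leqRHS]card_ord max_card.
pose labr (i : 'I_n) : option 'I_k.+1 :=
  if (i < m)%N then Some (inord (level i)) else None.
pose sigma (j : 'I_n) : 'I_n :=
  if (j < m)%N then insubd j (m.-1 - j)%N else j.
have sigmaE j : val (sigma j) = if (j < m)%N then (m.-1 - j)%N else j.
  rewrite /sigma; case: ifP => // jm; rewrite val_insubd ifT //.
  by rewrite /m; lia.
have sigma_inj : injective sigma.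
  move=> i j /(congr1 val); rewrite !sigmaE => e; apply: val_inj => /=; move: e.
  by case: ltnP => im; case: ltnP => jm /=; lia.
exists labr, (labr \o sigma); split.
- move=> c; rewrite -[LHS](card_preimset _ sigma_inj).
  by apply: eq_card => j; rewrite !inE.
- have -> : #|fibre labr None| = (\sum_(m <= i < n) 1)%N.
    rewrite big_geq_mkord /= sum1dep_card; apply: eq_card => i.
    by rewrite !inE /labr; case: ltnP.
  by rewrite sum_nat_const_nat muln1 /m subKn.
- move=> i j; apply: contraL => /existsP[l /= /andP[il jl]].
  have abl := hab l.
  have im : (i < m)%N by rewrite /m; lia.
  have jm : (j < m)%N by rewrite /m; lia.
  have sm : (sigma j < m)%N by rewrite [nat_of_ord _]sigmaE jm; lia.
  rewrite /allowed /labr /= im sm /=; apply/negP => /eqP[/(congr1 val)] /=.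
  rewrite !inordK // => lev_eq.
  (* Since j < beta l and alpha l + beta l <= m, the mirror row m - 1 - j is at least alpha l, hence
     beyond i: the threshold alpha l separates the two rows. *)
  suff : (level (sigma j) < level i)%N by rewrite lev_eq ltnn.
  apply: proper_card; apply/properP; split.
    apply/fintype.subsetP => l'; rewrite !inE [nat_of_ord _]sigmaE jm.
    by rewrite /m; lia.
  exists l; rewrite !inE // [nat_of_ord _]sigmaE jm -leqNgt /m; lia.
Qed.

Theorem theorem7p5 (R : realType) (a : nat) (ha : (2 <= a)%N)
  (eps : R) (heps : 0 < eps < 1) (k : nat) (hk : (0 < k)%N)
  (n0 : nat) (alpha beta : nat -> 'I_k -> nat)
  (alpha_bnd : forall n i, (n0 <= n)%N -> (1 <= alpha n i <= n)%N)
  (beta_bnd : forall n i, (n0 <= n)%N -> (1 <= beta n i <= n)%N)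
  (alpha_decr : forall n (i j : 'I_k), (n0 <= n)%N -> (i < j)%N ->
    (alpha n j < alpha n i)%N)
  (beta_incr : forall n (i j : 'I_k), (n0 <= n)%N -> (i < j)%N ->
    (beta n i < beta n j)%N)
  (d : nat -> measure_display) (T : forall n, measurableType (d n))
  (P : forall n, probability (T n) R)
  (M : forall n, T n -> 'M['Z_a]_n)
  (hM : forall n, (n0 <= n)%N ->
    balanced_stairs (P n) eps (alpha n) (beta n) (@M n))
  (hlim : forall i : 'I_k,
    (n%:R - (alpha n i)%:R - (beta n i)%:R : R) @[n --> \oo] --> +oo)
  (gT : finGroupType) (abG : abelian [set: gT]%SET)
  (expG : (exponent [set: gT]%SET %| a)%N) :
  'E_(P n)[fun w => (#|Sur (cok (M n w)) gT|)%:R]%E @[n --> \oo] --> 1%E.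
Proof.
have [w prw] := closed_prim_root_exists R[i] (ltn0Sn (Zp_trunc a).+1).
have [r r01 hr] := balanced_fourier_bound prw heps.
have [m0 [C [t [C0 t01 hC]]]] := energy_sum_bound (@dual_nz0 a gT)
  (card_dual prw ha abG expG) (perp_card prw ha abG expG)
  (option 'I_k.+1) r01.
apply/fine_cvgP; split.
  near=> n.
  have hn : (n0 <= n)%N by near: n; exact: nbhs_infty_ge.
  by rewrite (expectation_stairs (hM n hn)).
apply/cvgrPdist_le => e e0.
(* The error is split into e / 2 for the terms with h <> 0, through s, and e / 2 for the families
   that do not generate, through s1. Adding 1 to C and g0 keeps the denominators positive. *)
have [s hs] := @expr_small R t (e / 2 / (C + 1)) t01
  ltac:(by rewrite !divr_gt0 // ltr_wpDl).
pose g0 : R := #|{group gT}|%:R.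
have [s1 hs1] := @expr_small_all R (1 / 2) (e / 2 / (g0 + 1)) ltac:(lra)
  ltac:(by rewrite !divr_gt0 // ltr_wpDl // ler0n).
near=> n.
have hn : (n0 <= n)%N by near: n; exact: nbhs_infty_ge.
have hn1 : (s1 <= n)%N by near: n; exact: nbhs_infty_ge.
(* As s and m0 are fixed, the limit hypothesis leaves room for m0 * s more rows and columns beside
   each of the finitely many steps. *)
have hab : forall l : 'I_k, (alpha n l + beta n l + m0 * s <= n)%N.
  suff h : forall l : 'I_k, (m0 * s)%:R <= (n%:R - (alpha n l)%:R - (beta n l)%:R : R).
    by move=> l; rewrite -(ler_nat R) !natrD; have := h l; lra.
  near: n; apply: filter_forall => l.
  by have /cvgryPge := hlim l; apply.
have wn : (m0 * s <= n)%N.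
  exact: leq_trans (leq_addl _ _) (hab (Ordinal hk)).
have [labr [labc [eqc w0 al]]] := stair_labels wn hab.
rewrite /= (expectation_stairs (hM n hn)) /=.
set mu := entry_pmf _ _.
have mu0 i j u : 0 <= mu i j u by apply: point_mass_ge0.
have mu1 i j : \sum_u mu i j u = 1.
  exact: (sum_point_mass (P n) (measurable_entry (hM n hn) i j)).
have := expected_Sur_bound ha abG expG prw mu0 mu1 r01 (labr := labr)
  (labc := labc) (c0 := None).
move=> /(_ _)/wrap[].
  move=> i j /al nst c c0; apply: hr => // I maxI u.
  exact: (entry_pmf_balanced (hM n hn) u nst maxI).
have := hC _ labr labc None s eqc w0.
rewrite card_ord => b1 b2; have {b1 b2} b := le_trans b2 b1.
have /andP[g1 g2] := @card_generates gT R n.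
have {}hs1 := hs1 n hn1.
have cs : C * t ^+ s <= e / 2.
  apply: (@le_trans _ _ ((C + 1) * t ^+ s)).
    by rewrite ler_wpM2r ?lerDl // exprn_ge0; case/andP: t01 => /ltW.
  by rewrite mulrC -ler_pdivlMr // ltr_wpDl.
have gs : g0 * (1 / 2) ^+ n <= e / 2.
  apply: (@le_trans _ _ ((g0 + 1) * (1 / 2) ^+ n)).
    by rewrite ler_wpM2r ?lerDl // exprn_ge0 //; lra.
  by rewrite mulrC -ler_pdivlMr // ltr_wpDl // ler0n.
move: b; set gen := _ ^+ n * _%:R in g1 g2 *; rewrite -/g0 in g1.
set ex := expected_Sur _ _; rewrite !ler_norml => /andP[b1 b2].
by apply/andP; split; lra.
Unshelve. all: by end_near.
Qed.
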